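(* Let $N=(N_1,\dots,N_n)$ be a standard Gaussian random vector in $\mathbb{R}^n$ and let $M\subset\mathbb{R}^n$ be an arbitrary set. Then, for every $r>0$, $$\mathbb{E}\exp\left(\frac{1-r^{-2}}{2}\sup_{x\in(\operatorname{conv} M)\setminus\{0\}}\frac{\langle N,x\rangle_+^2}{|x|^2}\right)=\sum_{k=0}^n r^k\upsilon_k(\operatorname{pos} M).$$
   Context: All sets are tacitly assumed to be Borel. $\langle\cdot,\cdot\rangle$ and $|\cdot|$ are the Euclidean inner product and norm, and $a_+=\max(a,0)$. If the supremum is over the empty set it is interpreted as $0$. $\operatorname{conv} M$ is the convex hull of $M$. A non-empty set $C\subset\mathbb{R}^n$ is a convex cone if $\lambda_1x_1+\lambda_2x_2\in C$ for all $x_1,x_2\in C$ and $\lambda_1,\lambda_2\ge0$; $\operatorname{pos} M$ is the smallest convex cone containing $M$ (the set of all finite linear combinations of elements of $M$ with non-negative coefficients). The conic intrinsic volumes $\upsilon_0(C),\dots,\upsilon_n(C)$ of a convex cone $C\subset\mathbb{R}^n$ are the unique real numbers such that $$\mathbb{P}[\operatorname{dist}^2(Z,C)\le r]=\sum_{k=0}^n\beta_{k,n}(r)\,\upsilon_k(C)\quad\text{for all } r,$$ where $Z$ is uniformly distributed on the unit sphere $\mathbb{S}^{n-1}$, $\operatorname{dist}(Z,C)=\inf\{|Z-y|:y\in C\}$, and $\beta_{k,n}$ is the distribution function of the Beta distribution with parameters $(n-k)/2$ and $k/2$, with the degenerate cases: $\beta_{0,n}$ is the distribution function of the unit mass at $1$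 and $\beta_{n,n}$ that of the unit mass at $0$. *)

(* Defs.v *)
From HB Require Import structures.
From mathcomp Require Import all_boot all_order all_algebra.
From mathcomp Require Import all_classical all_reals all_analysis.

Set Implicit Arguments.
Unset Strict Implicit.
Unset Printing Implicit Defensive.

Import Order.TTheory GRing.Theory Num.Theory.
Import numFieldNormedType.Exports.

Local Open Scope classical_set_scope.
Local Open Scope ring_scope.

Section euclidean_space.
Context {R : realType} {n : nat}.
Implicit Types (x y : 'rV[R]_n) (A M C : set 'rV[R]_n).

Definition dotv x y : R := \sum_(i < n) x 0 i * y 0 i.

(* The library norm `|x| on 'rV[R]_n is the max norm, not the Euclidean one. *)
Definition enorm x : R := Num.sqrt (dotv x x).

(* The infimum is a genuine one whenever C is non-empty. *)
Definition dist_to x C : R := inf [set enorm (x - y) | y in C].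

Definition borel_set A : Prop := <<s [set U : set 'rV[R]_n | open U] >> A.

Definition conv_hull M : set 'rV[R]_n := smallest (@convex_set R 'rV[R]_n) M.

Definition convex_cone C : Prop :=
  C !=set0 /\
  forall x y (a b : R), C x -> C y -> 0 <= a -> 0 <= b -> C (a *: x + b *: y).

Definition pos_hull M : set 'rV[R]_n := smallest convex_cone M.

End euclidean_space.

Section random_vectors.
Context {R : realType} {d : measure_display} {T : measurableType d}
  {P : probability T R} {n : nat}.
Implicit Type X : 'I_n -> {RV P >-> R}.

Definition rvec X (w : T) : 'rV[R]_n := \row_i X i w.

Definition mutually_independent X : Prop :=
  forall (J : {set 'I_n}) (A : 'I_n -> set R), (forall i, measurable (A i)) ->
  P (\bigcap_(i in [set` J]) (X i @^-1` A i)) =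
  (\prod_(i in J) P (X i @^-1` A i))%E.

Definition standard_gaussian X : Prop :=
  mutually_independent X /\
  forall i (A : set R), measurable A ->
    distribution P (X i) A = normal_prob 0 1 A.

(* The uniform distribution on the unit sphere is the rotation invariant
   probability carried by it; row vectors are acted upon on the right. *)
Definition uniform_on_sphere X : Prop :=
  P [set w | enorm (rvec X w) = 1] = 1%E /\
  forall (Q : 'M[R]_n) (A : set 'rV[R]_n), Q *m Q^T = 1%:M -> borel_set A ->
    P [set w | A (rvec X w *m Q)] = P [set w | A (rvec X w)].

End random_vectors.

Section conic_intrinsic_volumes.
Context {R : realType}.

(* The library's beta_prob only has natural number parameters. *)
Definition beta_weight (a b t : R) : R := t `^ (a - 1) * (1 - t) `^ (b - 1).

Definition beta_cdf (a b r : R) : R :=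
  (\int[lebesgue_measure]_(t in `]0, 1[ `&` `]-oo, r]) beta_weight a b t) /
  (\int[lebesgue_measure]_(t in `]0, 1[) beta_weight a b t).

Definition beta_kn (n k : nat) (r : R) : R :=
  if k == 0%N then (1 <= r)%R%:R
  else if k == n then (0 <= r)%R%:R
  else beta_cdf ((n - k)%:R / 2) (k%:R / 2) r.

(* v is the family of conic intrinsic volumes of C: the defining identity
   determines v, as the functions beta_kn n 0, ..., beta_kn n n are linearly
   independent; the choice of Z is immaterial, as its law is determined. *)
Definition conic_intrinsic_volumes (n : nat) (C : set 'rV[R]_n)
    (v : 'I_n.+1 -> R) : Prop :=
  forall (d : measure_display) (T : measurableType d) (P : probability T R)
    (Z : 'I_n -> {RV P >-> R}), uniform_on_sphere Z ->
  forall r : R,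
    P [set w | dist_to (rvec Z w) C ^+ 2 <= r] =
    (\sum_(k < n.+1) beta_kn n k r * v k)%:E.

End conic_intrinsic_volumes.

(* Main.v *)
Require Import Defs.
From HB Require Import structures.
From mathcomp Require Import all_boot all_order all_algebra.
From mathcomp Require Import all_classical all_reals all_analysis.
From mathcomp Require Import measurable_realfun ring lra.

Set Implicit Arguments.
Unset Strict Implicit.
Unset Printing Implicit Defensive.

Import Order.TTheory GRing.Theory Num.Theory.
Import numFieldNormedType.Exports.

Local Open Scope classical_set_scope.
Local Open Scope ring_scope.

(* Let C = pos M. Distances to C are realised along rays, so the supremum in
   the exponent equals |N|^2 - dist(N, C)^2 = U (1 - D), where U = |N|^2,
   D = dist(Z, C)^2 and Z = N / |N|. Since N is rotation invariant, Z is uniform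
   on the sphere, and so it is under every conditional probability given
   an event on U; applying the definition of the intrinsic volumes
   to these conditional probabilities shows at once that D is independent
   of U and that its distribution function is that of the signed mixture
   sum_k v_k Beta((n-k)/2, k/2). Integrating U out with E exp(s U / 2) =
   (1 - s)^(-n/2) leaves E (D + (1 - D) r^-2)^(-n/2), and the Moebius
   substitution t / (t + (1 - t) r^-2) turns the Beta integral of index k
   into r^k. *)

(** * Densities, translations and distribution functions *)

(** The [v k] are known only through an identity between distribution functions: nothing is assumed
    about their signs. The mixture is therefore not treated as a measure; its negative part is moved
    to the side of the law of D, and two honest finite measures are compared. Only rotation
    invariance of the conditional laws of Z enters, never an explicit form of the uniform law. It
    rests on the rotation invariance of N, which is obtained without n-dimensional integration: an
    orthogonal matrix is reduced to the identity by plane rotations, and each plane rotation is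
    split into shears. The power r^k comes out exactly because the exponent n/2 left by integrating
    U out is the sum (n-k)/2 + k/2 of the Beta parameters: the powers of the denominator produced by
    the Moebius substitution then cancel it, and only a power of r^-2 with exponent -k/2 survives.
    Since 1 - s (1 - D) = D + (1 - D) r^-2 is positive for s = 1 - r^-2, all exponential moments
    involved are finite, for r above 1 as well as below. *)

Section density_measure.
Context {d} {T : measurableType d} {R : realType}.
Variables (mu : {measure set T -> \bar R}) (f : T -> R).
Hypotheses (mf : measurable_fun setT f) (f0 : forall x, 0 <= f x).
Local Open Scope ereal_scope.

(* The two proofs are arguments so that the measure structure can be inferred
   from the term alone. *)
Definition density_measure of measurable_fun setT f & (forall x, 0 <= f x)%R :=
  fun A : set T => \int[mu]_(x in A) (f x)%:E.

Local Notation nu := (density_measure mf f0).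

Let density0 : nu set0 = 0.
Proof. exact: integral_set0. Qed.

Let density_ge0 A : 0 <= nu A.
Proof. by apply: integral_ge0 => x _; rewrite lee_fin. Qed.

Let density_sigma_additive : semi_sigma_additive nu.
Proof.
move=> /= F mF tF mUF; rewrite /density_measure ge0_integral_bigcup//.
- apply: is_cvg_ereal_nneg_natsum_cond => n _ _.
  by apply: integral_ge0 => x _; rewrite lee_fin.
- exact/measurable_EFinP/measurable_funTS.
- by move=> x _; rewrite lee_fin.
Qed.

HB.instance Definition _ := isMeasure.Build _ _ _ nu
  density0 density_ge0 density_sigma_additive.

Let integral_density_indic (E : set T) (k : R) : measurable E -> (0 <= k)%R ->
  \int[nu]_x (k * \1_E x)%:E = \int[mu]_x (k * \1_E x * f x)%:E.
Proof.
move=> mE k0.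
under [LHS]eq_integral do rewrite EFinM.
rewrite (@ge0_integralZl _ _ _ nu setT measurableT (fun x => (\1_E x)%:E))//;
  last exact/measurable_EFinP.
under [RHS]eq_integral do rewrite -mulrA EFinM.
rewrite (@ge0_integralZl _ _ _ mu setT measurableT
  (fun x => (\1_E x * f x)%:E))//; last 2 first.
  by apply/measurable_EFinP; apply: measurable_funM.
  by move=> x _; rewrite lee_fin mulr_ge0.
congr (_ * _); rewrite integral_indic//= setIT/=.
rewrite [LHS]integral_mkcond; apply: eq_integral => x _.
by rewrite patchE indicE; case: ifPn => xE; rewrite ?mul1r ?mul0r.
Qed.

Import HBNNSimple.

(** Kept for an arbitrary [mu]: it serves for Lebesgue measure (normal and Beta densities) and for
    [P] itself, where the density is a product of functions of the coordinates. *)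
Lemma ge0_integral_density (g : T -> \bar R) :
  measurable_fun setT g -> (forall x, 0 <= g x) ->
  \int[nu]_x g x = \int[mu]_x (g x * (f x)%:E).
Proof.
move=> mg g0; pose g_ := nnsfun_approx measurableT mg.
transitivity (limn (fun n => \int[nu]_x (g_ n x)%:E)).
  rewrite -monotone_convergence//=.
  - apply: eq_integral => x _; apply/esym/cvg_lim => //=.
    exact: cvg_nnsfun_approx.
  - by move=> n; apply: measurableT_comp.
  - by move=> n x _; rewrite lee_fin.
  - by move=> x _ a b ab; rewrite lee_fin//; exact/lefP/nd_nnsfun_approx.
transitivity (limn (fun n => \int[mu]_x (g_ n x * f x)%:E)); last first.
  rewrite -monotone_convergence//=.
  - apply: eq_integral => x _; apply/cvg_lim => //=.
    under eq_fun do rewrite EFinM.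
    apply: cvgeZr => //.
    exact: cvg_nnsfun_approx.
  - by move=> n; apply/measurable_EFinP/measurable_funM.
  - by move=> n x _; rewrite lee_fin mulr_ge0.
  - move=> x _ a b ab; rewrite lee_fin ler_wpM2r//.
    exact/lefP/nd_nnsfun_approx.
congr (limn _); apply/funext => n.
under [LHS]eq_integral do rewrite fimfunE -fsumEFin//.
rewrite ge0_integral_fsum//; last 2 first.
  - by move=> r; exact/measurable_EFinP/measurableT_comp.
  - by move=> r x _; rewrite EFinM nnfun_muleindic_ge0.
transitivity (\int[mu]_x (\sum_(k \in range (g_ n)) (k * \1_(g_ n @^-1` [set k]) x * f x)%:E)).
  rewrite ge0_integral_fsum//; last 2 first.
  - by move=> r; apply/measurable_EFinP/measurable_funM => //; exact/measurable_funM.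
  - move=> r x _; rewrite EFinM mule_ge0 ?lee_fin//.
    by have := nnfun_muleindic_ge0 (g_ n) r x; rewrite -EFinM lee_fin.
  apply: eq_fsbigr => r /[!inE] -[x _ <-].
  by rewrite integral_density_indic.
apply: eq_integral => x _.
under eq_fsbigr do rewrite EFinM.
rewrite -ge0_mule_fsuml; last by move=> r; rewrite EFinM nnfun_muleindic_ge0.
by rewrite fsumEFin// -fimfunE.
Qed.

End density_measure.

Lemma integral_normal_prob (R : realType) (m s : R) (g : R -> \bar R) :
  measurable_fun setT g -> (forall x, (0 <= g x)%E) ->
  (\int[normal_prob m s]_x g x =
   \int[lebesgue_measure]_x (g x * (normal_pdf m s x)%:E))%E.
Proof.
move=> mg g0.
pose mf := measurable_normal_pdf m s; pose f0 := normal_pdf_ge0 m s.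
transitivity (\int[density_measure lebesgue_measure mf f0]_x g x)%E.
  exact: eq_measure_integral.
exact: ge0_integral_density.
Qed.

Section translation.
Context {R : realType}.
Local Notation mu := (@lebesgue_measure R).

Lemma lebesgue_measure_translation (c : R) (A : set R) : measurable A ->
  pushforward mu ((fun x => x + c) : _ -> measurableTypeR R) A = mu A.
Proof.
move=> mA.
have mc : measurable_fun setT ((fun x => x + c) : measurableTypeR R -> measurableTypeR R).
  exact: measurable_funD.
pose mfc : {mfun measurableTypeR R >-> measurableTypeR R} :=
  HB.pack (fun x => x + c) (isMeasurableFun.Build _ _ _ _ _ mc).
apply/esym/(@lebesgue_measure_unique R (pushforward mu mfc)) => //= _ [[a b]] _ <-.
rewrite /pushforward (_ : _ @^-1` _ = `]a - c, b - c]%classic); last first.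
  by apply/seteqP; split => x /=; rewrite !in_itv/= ltrBlDr lerBrDr.
rewrite !lebesgue_measure_itv/= !lte_fin ltrD2r.
by case: ifP => // _; rewrite -!EFinB; congr EFin; ring.
Qed.

Lemma ge0_integral_translation (c : R) (f : R -> \bar R) :
  measurable_fun setT f -> (forall x, (0 <= f x)%E) ->
  (\int[mu]_x f (x + c)%R = \int[mu]_x f x)%E.
Proof.
move=> mf f0.
have mc : measurable_fun setT ((fun x => x + c) : measurableTypeR R -> measurableTypeR R).
  exact: measurable_funD.
rewrite -[LHS](@ge0_integral_pushforward _ _ _ _ _ _ mc _ setT)//.
apply: eq_measure_integral => A mA _; exact: lebesgue_measure_translation.
Qed.

End translation.

(** Half-open intervals are differences of half-lines and form a generating class closed under
    intersection; finiteness makes the subtraction legitimate. *)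
Lemma eq_finite_measure_itvNyc (R : realType)
    (m1 m2 : {measure set (measurableTypeR R) -> \bar R}) :
  (m1 setT < +oo)%E -> (m2 setT < +oo)%E ->
  (forall t : R, m1 `]-oo, t]%classic = m2 `]-oo, t]%classic) ->
  forall A, measurable A -> m1 A = m2 A.
Proof.
move=> fm1 fm2 m12 A mA.
refine (@measure_unique _ R (measurableTypeR R) (@ocitv R)
  (fun n => `](- n%:R), n%:R]%classic) _ _ _ _ m1 m2 _ _ A mA) => //.
- exact: ocitvI.
- by move=> n; exact: is_ocitv.
- rewrite -subTset => x _; exists (Num.truncn `|x|).+1 => //=.
  have := truncnS_gt `|x|; rewrite in_itv/= ltr_norml => /andP[-> /ltW ->] //.
- move=> _ [[a b] _ <-]/=.
  have [ab|ba] := ltP a b; last by rewrite set_itv_ge ?measure0// bnd_simp -leNgt.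
  have -> : `]a, b]%classic = `]-oo, b]%classic `\` `]-oo, a]%classic.
    apply/seteqP; split => x /=; rewrite !in_itv/=.
      by move=> /andP[ax ->]; split => //; apply/negP; rewrite -ltNge.
    by move=> [-> /negP]; rewrite -ltNge => ->.
  have sab : `]-oo, a] `<=` `]-oo, b].
    by move=> x /=; rewrite !in_itv/= => /le_trans; apply; exact: ltW.
  rewrite !measureD//=.
  + by rewrite setIC (setIidl sab) !m12.
  + by rewrite (le_lt_trans _ fm2)// le_measure ?inE.
  + by rewrite (le_lt_trans _ fm1)// le_measure ?inE.
- by move=> k; rewrite (le_lt_trans _ fm1)// le_measure ?inE.
Qed.

(** * Rotation invariance of Gaussian vectors *)

Section plane_rotation.
Context {R : realType}.
Local Notation mu := (@lebesgue_measure R).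
Local Notation gam := (@normal_prob R 0 1).
Implicit Types f : R * R -> \bar R.

Local Lemma measurable_xshear (a : R) :
  measurable_fun setT (fun z : R * R => (z.1 + a * z.2, z.2)).
Proof.
apply: measurable_fun_pair; last exact: measurable_snd.
apply: measurable_funD; first exact: measurable_fst.
by apply: measurable_funM => //; exact: measurable_snd.
Qed.

Local Lemma measurable_yshear (b : R) :
  measurable_fun setT (fun z : R * R => (z.1, z.2 + b * z.1)).
Proof.
apply: measurable_fun_pair; first exact: measurable_fst.
apply: measurable_funD; first exact: measurable_snd.
by apply: measurable_funM => //; exact: measurable_fst.
Qed.

Lemma ge0_integral_yshear (b : R) f :
  measurable_fun setT f -> (forall z, 0 <= f z)%E ->
  (\int[mu]_x \int[mu]_y f (x, (y + b * x)%R) = \int[mu]_x \int[mu]_y f (x, y))%E.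
Proof.
move=> mf f0; apply: eq_integral => x _.
apply: (@ge0_integral_translation R (b * x) (fun y => f (x, y))) => //.
exact: measurableT_comp.
Qed.

Lemma ge0_integral_xshear (a : R) f :
  measurable_fun setT f -> (forall z, 0 <= f z)%E ->
  (\int[mu]_x \int[mu]_y f ((x + a * y)%R, y) = \int[mu]_x \int[mu]_y f (x, y))%E.
Proof.
move=> mf f0.
have mfa := measurableT_comp mf (measurable_xshear a).
pose g (z : R * R) := f ((z.1 + a * z.2)%R, z.2).
apply: (eq_trans (@fubini_tonelli _ _ _ _ R mu mu g mfa (fun z => f0 _))).
apply: (eq_trans _ (esym (@fubini_tonelli _ _ _ _ R mu mu f mf f0))).
apply: eq_integral => y _.
apply: (@ge0_integral_translation R (a * y) (fun x => f (x, y))) => //.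
exact: measurableT_comp.
Qed.

Lemma measurable_rotation (c s : R) :
  measurable_fun setT (fun z : R * R => (c * z.1 - s * z.2, s * z.1 + c * z.2)).
Proof.
apply: measurable_fun_pair.
  by apply: measurable_funB; apply: measurable_funM.
by apply: measurable_funD; apply: measurable_funM.
Qed.

(* Away from the half-turn, a rotation is a product of three shears, and
   shears preserve Lebesgue measure by Fubini and translation invariance. *)
Lemma ge0_integral_rotation (c s : R) f : c ^+ 2 + s ^+ 2 = 1 -> s != 0 ->
  measurable_fun setT f -> (forall z, 0 <= f z)%E ->
  (\int[mu]_x \int[mu]_y f ((c * x - s * y)%R, (s * x + c * y)%R) =
   \int[mu]_x \int[mu]_y f (x, y))%E.
Proof.
(* For an angle theta this is -tan(theta/2). The rotation is the x-shear by [a], then the y-shear by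
   [s], then the x-shear by [a] again, because 1 + s a = c and a (1 + c) = -s. *)
move=> cs1 s0 mf f0; pose a := (c - 1) / s.
rewrite -(ge0_integral_xshear a mf f0).
have mf1 := measurableT_comp mf (measurable_xshear a).
rewrite -(ge0_integral_yshear s mf1)/=; last by move=> z /=.
have mf2 := measurableT_comp mf1 (measurable_yshear s).
rewrite -(ge0_integral_xshear a mf2)/=; last by move=> z /=.
apply: eq_integral => x _; apply: eq_integral => y _.
have sa : s * a = c - 1 by rewrite /a mulrCA mulfV ?mulr1.
have ac : a * (1 + c) = - s.
  apply: (mulIf s0); rewrite -mulrA [X in a * X]mulrC mulrA [a * s]mulrC sa.
  by rewrite mulNr -expr2 -(addKr (c ^+ 2) (s ^+ 2)) cs1; ring.
congr (f (_, _)).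
  transitivity ((1 + s * a) * x + a * (1 + (1 + s * a)) * y); last by ring.
  by rewrite sa addrCA subrr addr0 ac; ring.
transitivity (s * x + (1 + s * a) * y); last by ring.
by rewrite sa; ring.
Qed.

Lemma ge0_integral_normal2 f :
  measurable_fun setT f -> (forall z, 0 <= f z)%E ->
  (\int[gam]_x \int[gam]_y f (x, y) =
   \int[mu]_x \int[mu]_y
     (f (x, y) * (normal_pdf 0 1 x * normal_pdf 0 1 y)%:E))%E.
Proof.
move=> mf f0; rewrite integral_normal_prob; last 2 first.
- exact: (@measurable_fun_fubini_tonelli_F _ _ _ _ R gam f).
- by move=> x; exact: integral_ge0.
apply: eq_integral => x _.
have mfx : measurable_fun setT (fun y => f (x, y)) by exact: measurableT_comp.
rewrite integral_normal_prob// -ge0_integralZr//.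
- by apply: eq_integral => y _; rewrite -muleA -EFinM mulrC.
- apply: emeasurable_funM => //; apply/measurable_EFinP.
  exact: measurable_normal_pdf.
- by move=> y _; rewrite mule_ge0// lee_fin normal_pdf_ge0.
- by rewrite lee_fin normal_pdf_ge0.
Qed.

(** The product of the two densities depends only on x^2 + y^2, so the claim reduces to the
    invariance of Lebesgue measure. *)
Lemma ge0_integral_normal2_rotation (c s : R) f :
  c ^+ 2 + s ^+ 2 = 1 -> s != 0 ->
  measurable_fun setT f -> (forall z, 0 <= f z)%E ->
  (\int[gam]_x \int[gam]_y f ((c * x - s * y)%R, (s * x + c * y)%R) =
   \int[gam]_x \int[gam]_y f (x, y))%E.
Proof.
move=> cs1 s0 mf f0.
have mrot := measurable_rotation c s.
have mfr := measurableT_comp mf mrot.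
apply: (eq_trans (ge0_integral_normal2 mfr (fun z => f0 _))).
apply: (eq_trans _ (esym (ge0_integral_normal2 mf f0))).
pose g (z : R * R) := (f z * (normal_pdf 0 1 z.1 * normal_pdf 0 1 z.2)%:E)%E.
have mg : measurable_fun setT g.
  apply: emeasurable_funM => //; apply/measurable_EFinP.
  by apply: measurable_funM; apply: measurableT_comp => //;
    exact: measurable_normal_pdf.
have g0 z : (0 <= g z)%E.
  by rewrite mule_ge0// lee_fin mulr_ge0 ?normal_pdf_ge0.
apply: (eq_trans _ (ge0_integral_rotation cs1 s0 mg g0)).
apply: eq_integral => x _; apply: eq_integral => y _; rewrite /g/=.
congr (_ * _%:E)%E; rewrite normal_pdfE ?oner_neq0// /normal_fun.
rewrite mulrACA -expRD [RHS]mulrACA -expRD; congr (_ * expR _).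
rewrite !subr0 -!mulrDl; congr (_ * _); rewrite -!opprD; congr (- _).
transitivity ((c ^+ 2 + s ^+ 2) * (x ^+ 2 + y ^+ 2)); last by ring.
by rewrite cs1 mul1r.
Qed.

End plane_rotation.

(** Here [m] need not be a probability: it is also applied to [P] restricted to an event, with the
    mass of the event absorbed in [m1]. *)
Lemma product_law d d1 d2 (T : measurableType d) (T1 : measurableType d1)
    (T2 : measurableType d2) (R : realType) (m : {measure set T -> \bar R})
    (m1 : {sigma_finite_measure set T1 -> \bar R})
    (m2 : {sigma_finite_measure set T2 -> \bar R}) (X1 : T -> T1) (X2 : T -> T2) :
  measurable_fun setT X1 -> measurable_fun setT X2 ->
  (forall A1 A2, measurable A1 -> measurable A2 ->
     m ((X1 @^-1` A1) `&` (X2 @^-1` A2)) = (m1 A1 * m2 A2)%E) ->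
  forall B, measurable B ->
    m ((fun w => (X1 w, X2 w)) @^-1` B) = (m1 \x m2)%E B.
Proof.
move=> mX1 mX2 m12 B mB.
have mX := measurable_fun_pair mX1 mX2.
pose X : {mfun T >-> (T1 * T2)%type} :=
  HB.pack (fun w => (X1 w, X2 w)) (isMeasurableFun.Build _ _ _ _ _ mX).
rewrite (@product_measure_unique _ _ _ _ _ m1 m2 (pushforward m X))//.
Qed.

Section gaussian_vector.
Context {R : realType} {d : measure_display} {T : measurableType d}
  {P : probability T R} {n : nat}.
Local Notation gam := (@normal_prob R 0 1).
Implicit Types X Y : T -> 'rV[R]_n.

Definition measurable_coord X :=
  forall i, measurable_fun setT (fun w => X w ord0 i).

Lemma measurable_box X (A : 'I_n -> set R) : measurable_coord X ->
  (forall i, measurable (A i)) -> measurable [set w | forall i, A i (X w ord0 i)].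
Proof.
move=> mX mA; rewrite (_ : [set w | _] = \bigcap_(i in [set: 'I_n])
    (fun w => X w ord0 i) @^-1` A i).
  apply: fin_bigcap_measurable; first exact: finite_finset.
  by move=> i _; rewrite -[X in measurable X]setTI; exact: mX.
by apply/seteqP; split => w /= h i => [_|]; apply: h.
Qed.

(** Independence and normal marginals in one product formula on full boxes. It is stated for a bare
    function, so that it applies directly to [X w *m Q]. *)
Definition gaussian_vector X := measurable_coord X /\
  forall A : 'I_n -> set R, (forall i, measurable (A i)) ->
    P [set w | forall i, A i (X w ord0 i)] = (\prod_i gam (A i))%E.

Lemma standard_gaussian_vector (N : 'I_n -> {RV P >-> R}) :
  standard_gaussian N -> gaussian_vector (rvec N).
Proof.
move=> [iN gN]; split.
  move=> i; rewrite (_ : (fun w => _) = N i); first exact: measurable_funPT.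
  by apply/funext => w; rewrite mxE.
move=> A mA; have := iN [set: 'I_n]%SET A mA.
rewrite (eq_bigl xpredT); last by move=> i; rewrite inE.
rewrite -(eq_bigr _ (fun i _ => gN i (A i) (mA i))) => <-; congr (P _).
apply/seteqP; split => w /= Aw i.
  by move=> _; have := Aw i; rewrite mxE.
by rewrite mxE; apply: Aw; rewrite /= inE.
Qed.

(** The normal density is even and Lebesgue measure is invariant under reflection. *)
Lemma gaussian_vector_sign X Y k : gaussian_vector X ->
  (forall w i, Y w ord0 i = if i == k then - X w ord0 k else X w ord0 i) ->
  gaussian_vector Y.
Proof.
move=> [mX gX] YE; split.
  move=> i; under eq_fun do rewrite YE; case: eqP => _; last exact: mX.
  by apply: measurableT_comp => //; exact: mX.
move=> A mA; pose A' i := if i == k then -%R @^-1` A i else A i.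
have mN (B : set R) : measurable B -> measurable (-%R @^-1` B).
  by move=> mB; rewrite -[X in measurable X]setTI; exact: oppr_measurable.
have -> : [set w | forall i, A i (Y w ord0 i)] =
    [set w | forall i, A' i (X w ord0 i)].
  by apply/seteqP; split => w /= Aw i; have := Aw i; rewrite YE /A';
    case: eqVneq => [->|].
rewrite gX; last by move=> i; rewrite /A'; case: ifP => // _; exact: mN.
apply: eq_bigr => i _; rewrite /A'; case: ifP => // _; rewrite /normal_prob.
have mpdf : measurable_fun setT (fun x => (normal_pdf 0 1 x)%:E : \bar R).
  by apply/measurable_EFinP; exact: measurable_normal_pdf.
have mo : measurable_fun setT (-%R : measurableTypeR R -> measurableTypeR R).
  exact: oppr_measurable.
transitivity (\int[lebesgue_measure]_(x in -%R @^-1` A i)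
    (((fun x => (normal_pdf 0 1 x)%:E) \o -%R) x))%E.
  apply: eq_integral => x _ /=.
  by rewrite normal_pdfE ?oner_neq0// /normal_fun !subr0 sqrrN.
have := @ge0_integral_pushforward _ _ _ _ R _ mo lebesgue_measure (A i)
  (fun x => (normal_pdf 0 1 x)%:E) (mA i) (measurable_funTS mpdf).
move=> <-; last by move=> x _; rewrite lee_fin normal_pdf_ge0.
apply: eq_measure_integral => B mB _; exact: lebesgue_measureN.
Qed.

Lemma normal_prob2_rotation (c s : R) (A1 A2 : set R) :
  c ^+ 2 + s ^+ 2 = 1 -> s != 0 -> measurable A1 -> measurable A2 ->
  (gam \x gam)%E ((fun z => (c * z.1 - s * z.2, s * z.1 + c * z.2)) @^-1`
    (A1 `*` A2)) = (gam A1 * gam A2)%E.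
Proof.
move=> cs1 s0 mA1 mA2.
have mrot := @measurable_rotation R c s.
have mA := measurableX mA1 mA2.
have mrA : measurable ((fun z : R * R =>
    (c * z.1 - s * z.2, s * z.1 + c * z.2)) @^-1` (A1 `*` A2)).
  by rewrite -[X in measurable X]setTI; exact: mrot.
pose f z := (\1_(A1 `*` A2) z)%:E : \bar R.
have mf : measurable_fun setT f by apply/measurable_EFinP; exact: measurable_indic.
have f0 z : (0 <= f z)%E by rewrite lee_fin.
have int1 (B : set (R * R)) : measurable B ->
    (gam \x gam)%E B = (\int[gam]_x \int[gam]_y (\1_B (x, y))%:E)%E.
  move=> mB; pose g (z : R * R) := (\1_B z)%:E : \bar R.
  have mg : measurable_fun setT g.
    by apply/measurable_EFinP; exact: measurable_indic.
  have g0 z : (0 <= g z)%E by rewrite lee_fin.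
  transitivity (\int[(gam \x gam)%E]_z g z)%E.
    have := integral_indic (gam \x gam)%E measurableT mB.
    by move=> ->; congr ((gam \x gam)%E _); rewrite setIT.
  exact: (@fubini_tonelli1 _ _ _ _ R gam gam g mg g0).
apply: (eq_trans (int1 _ mrA)).
apply: (eq_trans (ge0_integral_normal2_rotation cs1 s0 mf f0)).
apply: (eq_trans (esym (int1 _ mA))).
exact: (@product_measure1E _ _ _ _ R gam gam A1 A2 mA1 mA2).
Qed.

(** The constraints on the coordinates other than [i] and [k] form an event [W] that the rotation
    does not touch. Under [P] restricted to [W] the pair of coordinates [i], [k] has the planar
    Gaussian law times the constant [kap], and the planar invariance applies. *)
Lemma gaussian_vector_rotation X Y (i k : 'I_n) (c s : R) : i != k ->
  c ^+ 2 + s ^+ 2 = 1 -> s != 0 -> gaussian_vector X ->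
  (forall w, Y w ord0 i = c * X w ord0 i - s * X w ord0 k) ->
  (forall w, Y w ord0 k = s * X w ord0 i + c * X w ord0 k) ->
  (forall w j, j != i -> j != k -> Y w ord0 j = X w ord0 j) ->
  gaussian_vector Y.
Proof.
move=> ik cs1 s0 [mX gX] Yi Yk Yj; split.
  move=> j; have [->|ji] := eqVneq j i.
    by under eq_fun do rewrite Yi; apply: measurable_funB;
      apply: measurable_funM => //; exact: mX.
  have [->|jk] := eqVneq j k.
    by under eq_fun do rewrite Yk; apply: measurable_funD;
      apply: measurable_funM => //; exact: mX.
  by under eq_fun do rewrite Yj//; exact: mX.
move=> A mA.
pose W := [set w | forall j, j != i -> j != k -> A j (X w ord0 j)].
pose A' (B C : set R) j := if j == i then B else if j == k then C else A j.
have boxW (B C : set R) : measurable B -> measurable C ->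
    [set w | B (X w ord0 i)] `&` [set w | C (X w ord0 k)] `&` W =
    [set w | forall j, A' B C j (X w ord0 j)].
  move=> mB mC; rewrite /A'; apply/seteqP; split => w /=.
    move=> [[Bw Cw] Ww] j; have [->//|ji] := eqVneq j i.
    by have [->//|jk] := eqVneq j k; exact: Ww.
  move=> h; split; first by split; [have := h i|have := h k];
    rewrite ?eqxx// eq_sym (negbTE ik) ?eqxx.
  by move=> j ji jk; have := h j; rewrite (negbTE ji) (negbTE jk).
have mW : measurable W.
  rewrite (_ : W = [set w | forall j,
      (if (j == i) || (j == k) then setT else A j) (X w ord0 j)]).
    by apply: (@measurable_box _ (fun j =>
      if (j == i) || (j == k) then setT else A j)) => // j; case: ifP.
  apply/seteqP; split => w /= Ww j; first by case: ifPn => // /norP[]; exact: Ww.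
  by move=> ji jk; have := Ww j; rewrite (negbTE ji) (negbTE jk).
pose kap := (\prod_(j | (j != i) && (j != k)) gam (A j))%E.
have kap_fin : kap \is a fin_num.
  rewrite /kap; apply: prode_fin_num => j _; apply: fin_num_measure; exact: mA.
have kap0 : 0 <= fine kap.
  by apply: fine_ge0; rewrite /kap; apply: prode_ge0 => j _; exact: measure_ge0.
have PW (B C : set R) : measurable B -> measurable C ->
    P ([set w | B (X w ord0 i)] `&` [set w | C (X w ord0 k)] `&` W) =
    (kap * gam B * gam C)%E.
  move=> mB mC; rewrite boxW// (gX (A' B C)) /A'; last first.
    by move=> j; case: ifP => // _; case: ifP.
  rewrite (bigD1 i)//= eqxx (bigD1 k)/=; last by rewrite eq_sym.
  rewrite eq_sym (negbTE ik) eqxx -[RHS]muleA [RHS]muleC -[RHS]muleA.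
  congr (_ * (_ * _))%E.
  apply: eq_bigr => j /andP[ji jk].
  by rewrite (negbTE ji) (negbTE jk).
(* The constant [kap] is put into the first factor, so that the law on [W] is a product of two
   measures. *)
have law := @product_law _ _ _ T (measurableTypeR R) (measurableTypeR R) R (mrestr P mW)
  (mscale (NngNum kap0) gam) gam _ _ (mX i) (mX k).
pose B0 := (fun z : R * R => (c * z.1 - s * z.2, s * z.1 + c * z.2)) @^-1`
  (A i `*` A k).
have mB0 : measurable B0.
  rewrite -[X in measurable X]setTI; apply: measurable_rotation => //.
  exact: measurableX.
transitivity (mrestr P mW
    ((fun w => (X w ord0 i, X w ord0 k)) @^-1` B0)).
  rewrite /mrestr; congr (P _); apply/seteqP; split => w /=.
    move=> h; split.
      by split => /=; [have := h i; rewrite Yi|have := h k; rewrite Yk].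
    by move=> j ji jk; have := h j; rewrite Yj.
  move=> [[/= h1 h2] Ww] j; have [->|ji] := eqVneq j i; first by rewrite Yi.
  have [->|jk] := eqVneq j k; first by rewrite Yk.
  by rewrite Yj//; exact: Ww.
rewrite law//; last first.
  by move=> B C mB mC; rewrite [LHS]PW//= /mscale/= -[in LHS](fineK kap_fin).
transitivity (kap * (gam \x gam)%E B0)%E.
  rewrite /product_measure1 ge0_integral_mscale//=; first by rewrite fineK.
  exact: measurable_fun_xsection.
rewrite normal_prob2_rotation// [RHS](bigD1 i)//= [in RHS](bigD1 k)/=.
  by rewrite [RHS]muleA [LHS]muleC.
by rewrite eq_sym.
Qed.

End gaussian_vector.

(** * From plane rotations to all orthogonal matrices *)

Section gaussian_rotation_invariance.
Context {R : realType} {n : nat}.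
Implicit Types (Q : 'M[R]_n) (i j k : 'I_n).

Definition col_rotate Q k m (c s : R) : 'M[R]_n :=
  \matrix_(a, b) if b == k then c * Q a k - s * Q a m
                 else if b == m then s * Q a k + c * Q a m else Q a b.

Definition col_negate Q k : 'M[R]_n :=
  \matrix_(a, b) if b == k then - Q a k else Q a b.

Lemma orthogonal_mxP Q :
  Q *m Q^T = 1%:M <-> forall a b, \sum_j Q a j * Q b j = (a == b)%:R.
Proof.
split=> [QQ a b|QQ].
  transitivity ((Q *m Q^T) a b); last by rewrite QQ mxE.
  by rewrite mxE; apply: eq_bigr => j _; rewrite mxE.
apply/matrixP => a b; rewrite !mxE -QQ.
by apply: eq_bigr => j _; rewrite mxE.
Qed.

Lemma orthogonal_col_rotate Q k m c s : k != m -> c ^+ 2 + s ^+ 2 = 1 ->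
  Q *m Q^T = 1%:M -> col_rotate Q k m c s *m (col_rotate Q k m c s)^T = 1%:M.
Proof.
move=> km cs1 /orthogonal_mxP QQ; apply/orthogonal_mxP => a b.
rewrite -QQ (bigD1 k)//= (bigD1 m)/=; last by rewrite eq_sym.
rewrite [in RHS](bigD1 k)//= [in RHS](bigD1 m)/=; last by rewrite eq_sym.
rewrite !addrA; congr (_ + _); last first.
  apply: eq_bigr => j /andP[jk jm].
  by rewrite !mxE (negbTE jk) (negbTE jm).
rewrite !mxE !eqxx eq_sym (negbTE km).
transitivity ((c ^+ 2 + s ^+ 2) * (Q a k * Q b k + Q a m * Q b m)).
  by ring.
by rewrite cs1 mul1r.
Qed.

Lemma orthogonal_col_negate Q k : Q *m Q^T = 1%:M ->
  col_negate Q k *m (col_negate Q k)^T = 1%:M.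
Proof.
move=> /orthogonal_mxP QQ; apply/orthogonal_mxP => a b.
rewrite -QQ; apply: eq_bigr => j _; rewrite !mxE.
by case: eqP => [->|//]; rewrite mulrNN.
Qed.

Context {d : measure_display} {T : measurableType d} {P : probability T R}.
Implicit Type X : T -> 'rV[R]_n.
Local Notation gaussian := (gaussian_vector (P := P)).

(** The implication runs from the rotated matrix back to [Q], because the elimination simplifies [Q]
    step by step and ends at the identity. *)
Lemma gaussian_col_rotate X Q k m c s : k != m -> c ^+ 2 + s ^+ 2 = 1 ->
  s != 0 -> gaussian (fun w => X w *m col_rotate Q k m c s) ->
  gaussian (fun w => X w *m Q).
Proof.
move=> km cs1 s0 gX.
have Xk w : (X w *m col_rotate Q k m c s) ord0 k =
    c * (X w *m Q) ord0 k - s * (X w *m Q) ord0 m.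
  rewrite !mxE !mulr_sumr -sumrB; apply: eq_bigr => j _.
  by rewrite !mxE eqxx; ring.
have Xm w : (X w *m col_rotate Q k m c s) ord0 m =
    s * (X w *m Q) ord0 k + c * (X w *m Q) ord0 m.
  rewrite !mxE !mulr_sumr -big_split; apply: eq_bigr => j _ /=.
  by rewrite !mxE eqxx eq_sym (negbTE km); ring.
have split1 (x : R) : (c ^+ 2 + s ^+ 2) * x = x by rewrite cs1 mul1r.
(* The inverse rotation recovers the columns of [Q]. *)
apply: (@gaussian_vector_rotation _ _ _ _ _ _ _ k m c (- s) km _ _ gX).
- by rewrite sqrrN.
- by rewrite oppr_eq0.
- by move=> w; rewrite Xk Xm -[LHS]split1; ring.
- by move=> w; rewrite Xk Xm -[LHS]split1; ring.
- move=> w j jk jm; rewrite !mxE; apply: eq_bigr => i _.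
  by rewrite mxE (negbTE jk) (negbTE jm).
Qed.

Lemma gaussian_col_negate X Q k :
  gaussian (fun w => X w *m col_negate Q k) -> gaussian (fun w => X w *m Q).
Proof.
move=> gX; apply: (@gaussian_vector_sign _ _ _ _ _ _ _ k gX) => w i.
case: eqVneq => [->|ik]; rewrite !mxE -?sumrN; apply: eq_bigr => j _.
  by rewrite mxE eqxx mulrN opprK.
by rewrite mxE (negbTE ik).
Qed.

(* Plane rotations acting on the columns turn an orthogonal matrix into the
   identity row by row; each of them preserves Gaussian vectors. *)
Lemma gaussian_orthogonal X Q : Q *m Q^T = 1%:M -> gaussian X ->
  gaussian (fun w => X w *m Q).
Proof.
move=> + gX.
(* Outer induction on the number [t] of rows still to be treated; the first [r] rows are already
   those of the identity. *)
suff H t : forall r, (r + t)%N = n -> forall Q, Q *m Q^T = 1%:M ->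
    (forall j b, (j < r)%N -> Q j b = (j == b)%:R) ->
    gaussian (fun w => X w *m Q).
  by move=> oQ; exact: (H n 0%N).
elim: t => [|t IHt] r rn {}Q oQ Qr.
  have -> : Q = 1%:M.
    by apply/matrixP => a b; rewrite Qr ?mxE// -[r]addn0 rn.
  by under eq_fun do rewrite mulmx1.
have rltn : (r < n)%N by rewrite -rn -addSnnS leq_addr.
pose k := Ordinal rltn.
(* Inner induction within row [k]: the entries to the right of column [r + u] already vanish.
   Starting from [u = n] this condition is empty. *)
suff Hu u : forall Q, Q *m Q^T = 1%:M ->
    (forall j b, (j < r)%N -> Q j b = (j == b)%:R) ->
    (forall b : 'I_n, (r + u < b)%N -> Q k b = 0) -> gaussian (fun w => X w *m Q).
  apply: (Hu n) => // b; rewrite ltnNge.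
  by rewrite (leq_trans (ltnW (ltn_ord b))) ?leq_addl.
elim: u {Q oQ Qr} => [|u IHu] Q oQ Qr Qk.
  have Qkb b : b != k -> Q k b = 0.
    move=> bk; have [rb|] := ltnP r b; first by apply: Qk; rewrite addn0.
    rewrite leq_eqVlt => /predU1P[rb|br]; first by case/eqP: bk; exact/val_inj.
    (* To the left of the diagonal nothing has to be eliminated: row [b] is a unit vector, so its
       orthogonality to row [k] says that [Q k b] is zero. *)
    have /orthogonal_mxP/(_ k b) := oQ; rewrite eq_sym (negbTE bk) mulr0n => <-.
    rewrite (bigD1 b)//= big1 ?addr0; first by rewrite (Qr b)// eqxx mulr1.
    by move=> j jb; rewrite (Qr b)// eq_sym (negbTE jb) mulr0.
  have Qkk : Q k k ^+ 2 = 1.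
    have /orthogonal_mxP/(_ k k) := oQ; rewrite eqxx (bigD1 k)//= big1 ?addr0//.
    by move=> j jk; rewrite Qkb// mul0r.
  move/eqP: Qkk; rewrite sqrf_eq1 => /orP[|] /eqP Qkk.
    apply: (IHt r.+1) => //; first by rewrite addSnnS.
    move=> j b; rewrite ltnS leq_eqVlt => /predU1P[jr|jr]; last exact: Qr.
    have -> : j = k by exact: val_inj.
    by have [<-//|kb] := eqVneq k b; rewrite Qkb// eq_sym.
  (* The diagonal entry is -1 here; a sign change of column [k] repairs it. *)
  apply: (@gaussian_col_negate _ _ k); apply: (IHt r.+1).
  - by rewrite addSnnS.
  - exact: orthogonal_col_negate.
  - move=> j b; rewrite ltnS leq_eqVlt => /predU1P[jr|jr].
      have -> : j = k by exact: val_inj.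
      rewrite mxE [k == b]eq_sym; case: eqVneq => [_|bk].
        by rewrite Qkk opprK.
      by rewrite Qkb.
    rewrite mxE Qr//; case: eqVneq => [->|_]; last by rewrite Qr.
    by rewrite (_ : (j == k) = false) ?oppr0//; apply/negbTE;
      rewrite -val_eqE/= ltn_eqF.
have [nu|un] := leqP n (r + u.+1).
  apply: IHu => // b rub; suff : (b < b)%N by rewrite ltnn.
  by rewrite (leq_trans (ltn_ord b))// (leq_trans nu)// addnS.
pose m := Ordinal un; have km : k != m.
  by rewrite -val_eqE/= addnS ltn_eqF// ltnS leq_addr.
have mr j : (j < r)%N -> (j == k) = false /\ (j == m) = false.
  move=> jr; split; apply/negbTE; rewrite -val_eqE/= ltn_eqF//.
  by rewrite (leq_trans jr)// leq_addr.
(* An entry that is already zero is skipped: its rotation would have [s = 0], which the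
   decomposition into shears excludes. *)
have [Qm0|Qm0] := eqVneq (Q k m) 0.
  apply: IHu => // b; rewrite leq_eqVlt => /predU1P[bE|]; last first.
    by rewrite -addnS; exact: Qk.
  by rewrite (_ : b = m)//; apply: val_inj; rewrite /= addnS.
pose rho := Num.sqrt (Q k k ^+ 2 + Q k m ^+ 2).
have rho0 : 0 < rho.
  by rewrite sqrtr_gt0 ltr_wpDl ?sqr_ge0// exprn_even_gt0.
have rho2 : rho ^+ 2 = Q k k ^+ 2 + Q k m ^+ 2.
  by rewrite sqr_sqrtr// addr_ge0 ?sqr_ge0.
(* Chosen so that the new entry s Q_kk + c Q_km vanishes. *)
pose c := Q k k / rho; pose s := - Q k m / rho.
have cs1 : c ^+ 2 + s ^+ 2 = 1.
  by rewrite !expr_div_n sqrrN -mulrDl -rho2 mulfV// expf_neq0// gt_eqF.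
have s0 : s != 0.
  by rewrite /s mulf_neq0 ?oppr_eq0// invr_eq0 gt_eqF.
apply: (gaussian_col_rotate km cs1 s0); apply: IHu.
- exact: orthogonal_col_rotate.
- move=> j b jr; rewrite mxE !Qr//.
  have [jk jm] := mr j jr.
  rewrite jk jm !mulr0 subrr addr0.
  case: eqVneq => [->|_]; first by rewrite jk.
  by case: eqVneq => [->|_]; first by rewrite jm.
- move=> b; rewrite leq_eqVlt => /predU1P[bE|].
    have -> : b = m by apply: val_inj; rewrite /= addnS.
    by rewrite mxE eq_sym (negbTE km) eqxx /s /c; ring.
  rewrite -addnS => mb; rewrite mxE -val_eqE -[b == m]val_eqE/=.
  rewrite !gtn_eqF ?Qk//.
  by rewrite (leq_trans _ mb)// ltnS leq_addr.
Qed.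

End gaussian_rotation_invariance.

(** * Borel sets of row vectors *)

Section borel_row_vectors.
Context {R : realType} {n : nat}.

(** An open set is the union of the boxes with rational corners that it contains, and these are
    countably many. *)
Lemma preimage_open_measurable d (T : measurableType d) (X : T -> 'rV[R]_n)
    (U : set 'rV[R]_n) :
  measurable_coord X -> open U -> measurable (X @^-1` U).
Proof.
move=> mX oU.
pose box (q : {ffun 'I_n -> rat * rat}) := [set x : 'rV[R]_n |
  forall i, ratr (q i).1 < x ord0 i < ratr (q i).2].
have mbox q : measurable (X @^-1` box q).
  rewrite (_ : _ @^-1` _ = [set w | forall i,
      `]ratr (q i).1, ratr (q i).2[%classic (X w ord0 i)]).
    exact: (measurable_box (A := fun i => `]ratr (q i).1, ratr (q i).2[%classic)).
  by apply/seteqP; split => w /= h i; have := h i; rewrite /= in_itv.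
have -> : X @^-1` U =
    \bigcup_(q in [set q | box q `<=` U]) X @^-1` box q.
  apply/seteqP; split => [w /= Uw|w [q /= qU] /qU//].
  have /nbhs_ballP[e /= e0 eU] : nbhs (X w) U by exact: open_nbhs_nbhs.
  have Hl i : {q : rat | X w ord0 i - e < ratr q < X w ord0 i}.
    apply: cid; have [|q] := @rat_in_itvoo R (X w ord0 i - e) (X w ord0 i).
      by rewrite gtrBl.
    by rewrite in_itv/=; exists q.
  have Hr i : {q : rat | X w ord0 i < ratr q < X w ord0 i + e}.
    apply: cid; have [|q] := @rat_in_itvoo R (X w ord0 i) (X w ord0 i + e).
      by rewrite ltrDl.
    by rewrite in_itv/=; exists q.
  exists [ffun i => (projT1 (Hl i), projT1 (Hr i))] => /=.
    move=> x xb; apply: eU; split => // i0 i; rewrite ord1.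
    have := xb i; rewrite ffunE/=; case: (Hl i) => q1 /= q1P; case: (Hr i) => q2 /= q2P.
    by rewrite /ball/= ltr_norml; lra.
  move=> i; rewrite ffunE/=; case: (Hl i) => q1 /=; case: (Hr i) => q2 /=.
  by lra.
rewrite bigcup_mkcond; apply: countable_bigcupT_measurable; first exact: countableP.
by move=> q; case: ifP.
Qed.

Lemma preimage_borel_measurable d (T : measurableType d) (X : T -> 'rV[R]_n)
    (A : set 'rV[R]_n) :
  measurable_coord X -> borel_set A -> measurable (X @^-1` A).
Proof.
move=> mX; suff : borel_set `<=` [set A | measurable (X @^-1` A)] by apply.
apply: smallest_sub.
  split => /=.
  - by rewrite preimage_set0.
  - by move=> B mB; rewrite setTD preimage_setC; exact: measurableC.
  - by move=> F mF; rewrite preimage_bigcup; exact: bigcupT_measurable.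
by move=> U /= oU; exact: preimage_open_measurable.
Qed.

Definition boxes : set (set 'rV[R]_n) :=
  [set [set x : 'rV[R]_n | forall i, B i (x ord0 i)] |
    B in [set B : 'I_n -> set R | forall i, measurable (B i)]].

(** Row vectors as a measurable space. Boxes are closed under intersection, so a probability law on
    it is determined by its values on boxes; Borel sets are measurable in it by
    [preimage_borel_measurable] applied to the identity. *)
Definition boxV := g_sigma_algebraType boxes.

Lemma boxV_coord : measurable_coord (id : boxV -> 'rV[R]_n).
Proof.
move=> i _ B mB; rewrite setTI; apply: sub_sigma_algebra.
exists (fun j => if j == i then B else setT) => /=.
  by move=> j; case: ifP.
apply/seteqP; split => x /=; first by move/(_ i); rewrite eqxx.
by move=> Bx j; case: eqVneq => // ->.
Qed.

Lemma measurable_coord_boxV d (T : measurableType d) (X : T -> 'rV[R]_n) :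
  measurable_coord X -> measurable_fun setT (X : T -> boxV).
Proof.
move=> mX; refine (@measurability _ _ T boxV setT X boxes _ _) => //.
move=> _ [_ [B /= mB <-] <-]; rewrite setTI.
exact: measurable_box.
Qed.

Lemma eq_law_boxes d (T : measurableType d) (P : probability T R)
    (X Y : T -> 'rV[R]_n) (A : set boxV) :
  measurable_coord X -> measurable_coord Y ->
  (forall B : 'I_n -> set R, (forall i, measurable (B i)) ->
    P [set w | forall i, B i (X w ord0 i)] =
    P [set w | forall i, B i (Y w ord0 i)]) ->
  measurable A -> P (X @^-1` A) = P (Y @^-1` A).
Proof.
move=> mX mY XY mA.
pose X' : {mfun T >-> boxV} :=
  HB.pack X (isMeasurableFun.Build _ _ _ _ _ (measurable_coord_boxV mX)).
pose Y' : {mfun T >-> boxV} :=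
  HB.pack Y (isMeasurableFun.Build _ _ _ _ _ (measurable_coord_boxV mY)).
apply: (@measure_unique _ R boxV boxes (fun=> setT) _ _ _ _
  (distribution P X') (distribution P Y') _ _ A mA) => //.
- move=> _ _ [B mB <-] [C mC <-]; exists (fun i => B i `&` C i).
    by move=> i; exact: measurableI.
  apply/seteqP; split => x /=.
    by move=> h; split => i; have [] := h i.
  by move=> [hB hC] i; split.
- move=> _; exists (fun=> setT) => //.
  by apply/seteqP; split.
- by rewrite bigcup_const.
- by move=> _ [B mB <-]; exact: XY.
- by move=> _; rewrite (le_lt_trans (probability_le1 _ _)) ?ltry.
Qed.

End borel_row_vectors.

(** * Cones and distances *)

Section euclidean_geometry.
Context {R : realType} {n : nat}.
Implicit Types (x y z : 'rV[R]_n) (C M : set 'rV[R]_n).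

Lemma dotvC x y : dotv x y = dotv y x.
Proof. by apply: eq_bigr => i _; rewrite mulrC. Qed.

Lemma dotvDr x y z : dotv x (y + z) = dotv x y + dotv x z.
Proof. by rewrite -big_split; apply: eq_bigr => i _; rewrite mxE mulrDr. Qed.

Lemma dotvZr a x y : dotv x (a *: y) = a * dotv x y.
Proof. by rewrite mulr_sumr; apply: eq_bigr => i _; rewrite mxE; ring. Qed.

Lemma dotvZl a x y : dotv (a *: x) y = a * dotv x y.
Proof. by rewrite dotvC dotvZr dotvC. Qed.

Lemma dotvDl x y z : dotv (x + y) z = dotv x z + dotv y z.
Proof. by rewrite dotvC dotvDr !(dotvC z). Qed.

Lemma dotvv_ge0 x : 0 <= dotv x x.
Proof. by apply: sumr_ge0 => i _; rewrite -expr2 sqr_ge0. Qed.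

Lemma dotvv_eq0 x : (dotv x x == 0) = (x == 0).
Proof.
apply/eqP/eqP => [x0|->]; last by rewrite /dotv big1// => i _; rewrite mxE mul0r.
apply/rowP => i; rewrite mxE; apply/eqP; rewrite -sqrf_eq0 expr2; apply/eqP.
by apply: (psumr_eq0P _ x0) => // j _; rewrite -expr2 sqr_ge0.
Qed.

Lemma enorm_ge0 x : 0 <= enorm x.
Proof. exact: sqrtr_ge0. Qed.

Lemma sqr_enorm x : enorm x ^+ 2 = dotv x x.
Proof. by rewrite sqr_sqrtr// dotvv_ge0. Qed.

Lemma enorm0 : enorm (0 : 'rV[R]_n) = 0.
Proof.
by apply/eqP; rewrite -sqrf_eq0 sqr_enorm dotvv_eq0.
Qed.

Lemma enorm_eq0 x : (enorm x == 0) = (x == 0).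
Proof. by rewrite -sqrf_eq0 sqr_enorm dotvv_eq0. Qed.

Lemma enormZ a x : enorm (a *: x) = `|a| * enorm x.
Proof. by rewrite /enorm dotvZl dotvZr mulrA -expr2 sqrtrM ?sqr_ge0// sqrtr_sqr. Qed.

Lemma sqr_enormB x y :
  enorm (x - y) ^+ 2 = enorm x ^+ 2 - 2 * dotv x y + enorm y ^+ 2.
Proof.
rewrite !sqr_enorm dotvDl !dotvDr -scaleN1r !(dotvZl, dotvZr) (dotvC y x).
by ring.
Qed.

Lemma enorm_mulmx_orthogonal x (Q : 'M[R]_n) : Q *m Q^T = 1%:M ->
  enorm (x *m Q) = enorm x.
Proof.
move=> QQ.
have dE y : dotv y y = (y *m y^T) 0 0.
  by rewrite mxE; apply: eq_bigr => i _; rewrite mxE.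
by rewrite /enorm !dE trmx_mul mulmxA -(mulmxA x) QQ mulmx1.
Qed.

Lemma dist_to_has_inf x C : C !=set0 -> has_inf [set enorm (x - y) | y in C].
Proof.
move=> [y Cy]; split; first by exists (enorm (x - y)); exists y.
by exists 0 => _ [z _ <-]; exact: enorm_ge0.
Qed.

Lemma dist_to_ge0 x C : 0 <= dist_to x C.
Proof.
have [->|/set0P C0] := eqVneq C set0; first by rewrite /dist_to image_set0 inf0.
by apply: lb_le_inf; [case: (dist_to_has_inf x C0)|move=> _ [z _ <-]; exact: enorm_ge0].
Qed.

Lemma dist_to_le x y C : C y -> dist_to x C <= enorm (x - y).
Proof.
by move=> Cy; apply: ge_inf; [case: (@dist_to_has_inf x C); [exists y|]|exists y].
Qed.

Lemma le_dist_to x C a : C !=set0 -> (forall y, C y -> a <= enorm (x - y)) ->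
  a <= dist_to x C.
Proof.
move=> C0 h; apply: lb_le_inf; first by case: (dist_to_has_inf x C0).
by move=> _ [y Cy <-]; exact: h.
Qed.

Lemma convex_cone0 C : convex_cone C -> C 0.
Proof.
move=> [[y Cy] hC].
have <- : 0 *: y + 0 *: y = 0 by rewrite scale0r addr0.
by apply: hC.
Qed.

Lemma convex_cone_pos_hull M : convex_cone (pos_hull M).
Proof.
split; first by exists 0 => C [/convex_cone0].
move=> x y a b Mx My a0 b0 C hC; have [[_ cC] _] := hC.
by apply: cC => //; [exact: Mx|exact: My].
Qed.

Lemma convex_coneZ C x a : convex_cone C -> C x -> 0 <= a -> C (a *: x).
Proof.
move=> hC Cx a0; rewrite -[a *: x]addr0 -(scale0r x).
by case: hC => _; apply.
Qed.

Lemma conv_hull_sub_pos_hull M : conv_hull M `<=` pos_hull M.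
Proof.
apply: smallest_sub; last exact: sub_gen_smallest.
move=> x y l /[!inE] Mx My; case: (convex_cone_pos_hull M) => _; apply => //.
by rewrite subr_ge0.
Qed.

Lemma pos_hull_ray M x : pos_hull M x -> x != 0 ->
  exists y a, [/\ conv_hull M y, 0 < a & x = a *: y].
Proof.
move=> Mx x0.
pose K := [set x : 'rV[R]_n | x = 0 \/
  exists y a, [/\ conv_hull M y, 0 < a & x = a *: y]].
suff : K x by move=> [/eqP|//]; rewrite (negbTE x0).
apply: Mx; split; last first.
  move=> y My; right; exists y, 1; split; rewrite ?scale1r//.
  exact: sub_gen_smallest.
split; first by exists 0; left.
move=> u v a b Ku Kv.
rewrite !le_eqVlt => /predU1P[<-|a0] /predU1P[<-|b0].
- by left; rewrite !scale0r addr0.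
- rewrite scale0r add0r; case: Kv => [->|[y [c [My c0 ->]]]].
    by left; rewrite scaler0.
  by right; exists y, (b * c); rewrite mulr_gt0// scalerA.
- rewrite scale0r addr0; case: Ku => [->|[y [c [My c0 ->]]]].
    by left; rewrite scaler0.
  by right; exists y, (a * c); rewrite mulr_gt0// scalerA.
case: Ku => [->|[y [c [My c0 ->]]]]; case: Kv => [->|[z [e [Mz e0 ->]]]].
- by left; rewrite !scaler0 addr0.
- by right; exists z, (b * e); rewrite mulr_gt0// scalerA scaler0 add0r.
- by right; exists y, (a * c); rewrite mulr_gt0// scalerA scaler0 addr0.
right; pose s := a * c + b * e.
have s0 : 0 < s by rewrite addr_gt0// mulr_gt0.
have l0 : 0 <= a * c / s by rewrite divr_ge0 ?mulr_ge0// ltW.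
have l1 : a * c / s <= 1.
  by rewrite ler_pdivrMr// mul1r lerDl mulr_ge0// ltW.
pose l := Itv01 l0 l1.
(* The vector a c y + b e z is its total weight [s] times a convex combination of [y] and [z]. *)
exists (a * c / s *: y + (1 - a * c / s) *: z), s; split => //.
  move=> C hC; have [cC _] := hC.
  have /= := cC y z l; rewrite !inE; apply; [exact: My|exact: Mz].
rewrite scalerDr !scalerA mulrCA mulfV ?gt_eqF// mulr1; congr (_ + _ *: _).
rewrite mulrBr mulr1 mulrCA mulfV ?gt_eqF// mulr1 /s.
by rewrite addrC addKr.
Qed.

(* The distance to a cone is realised along rays, and the minimum of
   |x - a y|^2 over a >= 0 is |x|^2 - <x,y>_+^2 / |y|^2. *)
Lemma sup_sqr_cos_dist M x :
  sup [set Num.max (dotv x y) 0 ^+ 2 / enorm y ^+ 2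
      | y in conv_hull M `\ (0 : 'rV[R]_n)] =
  enorm x ^+ 2 - dist_to x (pos_hull M) ^+ 2.
Proof.
set S := [set _ | _ in _]; set C := pos_hull M.
have cC : convex_cone C := convex_cone_pos_hull M.
have C0 : C !=set0 by exists 0; exact: convex_cone0.
have dx : dist_to x C <= enorm x.
  by rewrite -[leRHS](congr1 (@enorm _ _) (subr0 x)) dist_to_le//; exact: convex_cone0.
have ubS : ubound S (enorm x ^+ 2 - dist_to x C ^+ 2).
  move=> _ [y [My /eqP y0] <-]; rewrite lerBrDr addrC -lerBrDr.
  (* The minimiser of |x - a y| over a >= 0; the ray point it gives bounds the distance from
     above. *)
  pose a := Num.max (dotv x y) 0 / enorm y ^+ 2.
  have ny0 : 0 < enorm y ^+ 2 by rewrite exprn_gt0// lt_neqAle eq_sym enorm_eq0 y0 enorm_ge0.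
  have Cay : C (a *: y).
    apply: convex_coneZ => //; first exact: conv_hull_sub_pos_hull.
    by rewrite divr_ge0 ?sqr_ge0// le_max lexx orbT.
  have : dist_to x C ^+ 2 <= enorm (x - a *: y) ^+ 2.
    by rewrite lerXn2r ?nnegrE ?dist_to_ge0 ?enorm_ge0// dist_to_le.
  move=> /le_trans; apply.
  rewrite sqr_enormB enormZ exprMn real_normK ?num_real// dotvZr.
  rewrite /a; case: (leP (dotv x y) 0) => xy.
    by rewrite !mul0r expr0n/= !mul0r mulr0 subr0 addr0.
  rewrite le_eqVlt; apply/orP; left; apply/eqP; field.
  by rewrite -sqrf_eq0 gt_eqF.
(* With no non-zero point in the hull, the supremum has its default value 0; the cone is then {0}
   and the distance equals |x|. *)
have [S0|S0] := eqVneq S set0.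
  rewrite S0 sup0; have C00 z : C z -> z = 0.
    move=> Cz; apply/eqP; apply: contrapT => /negP z0.
    have [y [a [My a0 zE]]] := pos_hull_ray Cz z0.
    suff : S (Num.max (dotv x y) 0 ^+ 2 / enorm y ^+ 2) by rewrite S0.
    by exists y => //; split => // y0; move: z0; rewrite zE y0 scaler0 eqxx.
  have <- : enorm x = dist_to x C; last by rewrite subrr.
  apply/eqP; rewrite eq_le dx andbT; apply: le_dist_to => // y /C00 ->.
  by rewrite subr0.
have supS : has_sup S by split; [exact/set0P|exists (enorm x ^+ 2 - dist_to x C ^+ 2)].
apply/eqP; rewrite eq_le; apply/andP; split; first exact: ge_sup (supS.1) ubS.
(* It remains to bound the squared distance below by [q], which is |x|^2 minus the supremum. For
   positive [q] this follows by comparing its square root with |x - z| for each [z] in the cone. *)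
rewrite lerBlDr -lerBlDl; set q := _ - _.
have Sge0 : 0 <= sup S.
  have [s Ss] := supS.1; have := sup_upper_bound supS Ss; apply: le_trans.
  by have [y _ <-] := Ss; rewrite divr_ge0 ?sqr_ge0.
have [q0|q0] := leP q 0; first by rewrite (le_trans q0)// sqr_ge0.
rewrite -(sqr_sqrtr (ltW q0)) ler_pXn2r ?nnegrE ?sqrtr_ge0 ?dist_to_ge0//.
apply: le_dist_to => // z Cz.
rewrite -(@ler_pXn2r _ 2) ?nnegrE ?sqrtr_ge0 ?enorm_ge0//.
rewrite (sqr_sqrtr (ltW q0)).
have [->|z0] := eqVneq z 0; first by rewrite subr0 /q gerBl.
have [y [a [My a0 zE]]] := pos_hull_ray Cz z0.
have y0 : y != 0 by apply: contra_neq z0 => y0; rewrite zE y0 scaler0.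
have ny0 : 0 < enorm y ^+ 2 by rewrite exprn_gt0// lt_neqAle eq_sym enorm_eq0 y0 enorm_ge0.
have Sy : Num.max (dotv x y) 0 ^+ 2 / enorm y ^+ 2 <= sup S.
  apply: sup_upper_bound => //; exists y => //; split => //.
  by move/eqP; rewrite (negbTE y0).
rewrite lerBlDr -lerBlDl; apply: le_trans Sy.
rewrite zE sqr_enormB enormZ exprMn real_normK ?num_real// dotvZr.
rewrite ler_pdivlMr//.
set u := enorm y ^+ 2 in ny0 *; set t := dotv x y.
have [t0|t0] := leP t 0.
  rewrite expr0n/= opprD opprB addrA addrCA addrC !addrA.
  apply: mulr_le0_ge0; last exact: ltW.
  have : 0 <= a ^+ 2 * u by rewrite mulr_ge0 ?sqr_ge0 ?ltW.
  have : a * t <= 0 by rewrite mulr_ge0_le0// ltW.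
  by lra.
have := sqr_ge0 (t - a * u).
by nra.
Qed.

Lemma dist_to_scale_le C x a : convex_cone C -> 0 < a ->
  dist_to (a *: x) C <= a * dist_to x C.
Proof.
move=> cC a0; rewrite -ler_pdivrMl//; apply: le_dist_to; first by case: cC.
move=> y Cy; rewrite ler_pdivrMl// -[X in X * _](gtr0_norm a0) -enormZ scalerBr.
by apply: dist_to_le; apply: convex_coneZ => //; exact: ltW.
Qed.

Lemma dist_to_scale C x a : convex_cone C -> 0 < a ->
  dist_to (a *: x) C = a * dist_to x C.
Proof.
move=> cC a0; apply/eqP; rewrite eq_le dist_to_scale_le//=.
rewrite -ler_pdivlMl//.
(* The reverse inequality is the same lemma for the factor a^-1 at the point a x. *)
rewrite -{1}(scale1r x) -(mulVf (lt0r_neq0 a0)) -scalerA.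
by apply: dist_to_scale_le; rewrite ?invr_gt0.
Qed.

Lemma dist_to_le_enorm C x : convex_cone C -> dist_to x C <= enorm x.
Proof. by move=> /convex_cone0/(dist_to_le x); rewrite subr0. Qed.

Lemma measurable_dotvv d (T : measurableType d) (X : T -> 'rV[R]_n) :
  measurable_coord X -> measurable_fun setT (fun w => dotv (X w) (X w)).
Proof.
move=> mX; apply: measurable_sum => i.
by apply: measurable_funM; exact: mX.
Qed.

Lemma measurable_enorm d (T : measurableType d) (X : T -> 'rV[R]_n) :
  measurable_coord X -> measurable_fun setT (fun w => enorm (X w)).
Proof.
move=> mX; apply: measurableT_comp; last exact: measurable_dotvv.
by apply: continuous_measurable_fun; exact: sqrt_continuous.
Qed.

Lemma continuous_enormB y : continuous (fun x => enorm (x - y)).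
Proof.
move=> x.
apply: (@continuous_comp _ _ _ (fun x => dotv (x - y) (x - y)) Num.sqrt);
  last exact: sqrt_continuous.
have cx i : (z - y) 0 i @[z --> x] --> (x - y) 0 i.
  rewrite !mxE; under eq_fun do rewrite !mxE.
  apply: (@cvgB _ R^o _ (nbhs x) _ (fun z : 'rV[R]_n => z 0 i) (fun=> y 0 i)).
    exact: coord_continuous.
  exact: cvg_cst.
apply: cvg_big; [exact: add_continuous|exact: (@nbhs_filter _ x)|].
by move=> i _; apply: cvgM; [exact: (@nbhs_filter _ x)|exact: cx|exact: cx].
Qed.

(** The set where the distance is below [t] is a union of open balls centred in [C], hence open,
    whatever the regularity of [C]. *)
Lemma measurable_dist_to d (T : measurableType d) (X : T -> 'rV[R]_n) C :
  C !=set0 -> measurable_coord X ->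
  measurable_fun setT (fun w => dist_to (X w) C).
Proof.
move=> C0 mX; apply: (measurability _ (RGenInftyO.measurableE R)) => //.
move=> _ [_ [t ->] <-]; rewrite setTI.
rewrite [X in measurable X](_ : _ = X @^-1`
    \bigcup_(y in C) ((fun x => enorm (x - y)) @^-1` `]-oo, t[)).
  apply: preimage_open_measurable => //; apply: bigcup_open => y _.
  by apply: open_comp; [move=> x _; exact: continuous_enormB|exact: interval_open].
apply/seteqP; split => w /=; rewrite in_itv/= => h; last first.
  by have [y Cy /=] := h; rewrite in_itv/=; apply/le_lt_trans/dist_to_le.
apply: contrapT => nh; move: h; apply/negP; rewrite -leNgt.
apply: le_dist_to => // y Cy; rewrite leNgt; apply/negP => h.
by apply: nh; exists y => //=; rewrite in_itv.
Qed.

End euclidean_geometry.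

(** * Exponential moments of Gaussian vectors *)

(** Tilting the standard density by exp(s x^2 / 2) gives q^-1 times the centred normal density of
    standard deviation q^-1, where q^2 = 1 - s. *)
Lemma integral_expR_normal_prob (R : realType) (s : R) : s < 1 ->
  (\int[normal_prob 0 1]_x (expR (s / 2 * x ^+ 2))%:E =
   ((Num.sqrt (1 - s))^-1)%:E)%E.
Proof.
move=> s1; have q0 : 0 < Num.sqrt (1 - s) by rewrite sqrtr_gt0 subr_gt0.
set q := Num.sqrt (1 - s) in q0 *.
have q2 : q ^+ 2 = 1 - s by rewrite sqr_sqrtr// subr_ge0 ltW.
have qV0 : q^-1 != 0 by rewrite invr_eq0 gt_eqF.
rewrite integral_normal_prob//; last first.
  apply/measurable_EFinP; apply: measurableT_comp => //.
  by apply: measurable_funM => //; exact: measurable_funX.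
transitivity (\int[lebesgue_measure]_x (q^-1%:E * (normal_pdf 0 q^-1 x)%:E))%E.
  apply: eq_integral => x _; rewrite -!EFinM; congr EFin.
  rewrite !normal_pdfE ?oner_neq0// /normal_fun mulrCA -expRD [RHS]mulrA.
  congr (_ * expR _).
    rewrite /normal_peak expr1n mul1r exprVn -mulrnAr sqrtrM ?invr_ge0 ?sqr_ge0//.
    by rewrite -exprVn sqrtr_sqr gtr0_norm ?invr_gt0// invfM mulrA divff ?mul1r.
  rewrite subr0 expr1n exprVn q2; field.
  by rewrite subr_eq0 eq_sym lt_eqF.
rewrite ge0_integralZl//.
- by rewrite integral_normal_pdf mule1.
- by apply/measurable_EFinP; exact: measurable_normal_pdf.
- by move=> x _; rewrite lee_fin normal_pdf_ge0.
- by rewrite lee_fin invr_ge0 ltW.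
Qed.

Section gaussian_product.
Context {R : realType} {d : measure_display} {T : measurableType d}
  {P : probability T R} {n : nat} (X : T -> 'rV[R]_n).
Hypothesis gX : gaussian_vector (P := P) X.
Local Notation gam := (@normal_prob R 0 1).

Let integral_normal_indic (A : set R) : measurable A ->
  (\int[gam]_x (\1_A x)%:E = gam A)%E.
Proof. by move=> mA; rewrite integral_indic// -[in RHS](setIT A). Qed.

Lemma ge0_integral_gaussian_prod (g : 'I_n -> R -> R) :
  (forall i, measurable_fun setT (g i)) -> (forall i x, 0 <= g i x) ->
  (forall i, (\int[gam]_x (g i x)%:E < +oo)%E) ->
  (\int[P]_w (\prod_i g i (X w ord0 i))%:E = \prod_i \int[gam]_x (g i x)%:E)%E.
Proof.
have [mX boxX] := gX.
(* Induction on the number [m] of leading factors that may be arbitrary; the others are indicators.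
   For [m = 0] this is the product formula on boxes. *)
suff H m (B : 'I_n -> set R) : (forall i, measurable (B i)) ->
    forall g : 'I_n -> R -> R,
    (forall i, measurable_fun setT (g i)) -> (forall i x, 0 <= g i x) ->
    (forall i, (\int[gam]_x (g i x)%:E < +oo)%E) ->
    (forall i : 'I_n, (m <= i)%N -> g i = \1_(B i)) ->
    (\int[P]_w (\prod_i g i (X w ord0 i))%:E =
     \prod_i \int[gam]_x (g i x)%:E)%E.
  move=> mg g0 goo; apply: (H n (fun=> setT)) => // i.
  by rewrite leqNgt ltn_ord.
elim: m B => [|m IH] B mB {}g mg g0 goo gB.
  transitivity (P [set w | forall i, B i (X w ord0 i)]).
    rewrite -[in RHS](setIT [set w | _]) -integral_indic//; last first.
      exact: measurable_box.
    apply: eq_integral => w _; congr EFin; rewrite indicE.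
    have [wB|wB] := boolP (_ \in _).
      rewrite big1// => i _; rewrite gB// indicE mem_set//.
      by move: wB; rewrite inE; apply.
    have [i Bi] : exists i, ~ B i (X w ord0 i).
      by apply/existsNP => wB'; move/negP: wB; apply; rewrite inE.
    by rewrite (bigD1 i)//= gB// indicE memNset// mul0r.
  rewrite boxX//; apply: eq_bigr => i _.
  by rewrite gB// integral_normal_indic.
have [nm|mn] := leqP n m.
  apply: (IH B) => // i mi; suff : (i < i)%N by rewrite ltnn.
  by rewrite (leq_trans (ltn_ord i))// (leq_trans nm).
pose k := Ordinal mn.
have mgX i : measurable_fun setT (fun w => g i (X w ord0 i)).
  by apply: measurableT_comp => //; exact: mX.
have mgk : measurable_fun setT (fun x : measurableTypeR R => (g k x)%:E).
  by apply/measurable_EFinP; exact: mg.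
pose f w := \prod_(i | i != k) g i (X w ord0 i).
have mf : measurable_fun setT f.
  rewrite (_ : f = fun w => \prod_(i <- [seq i <- index_enum 'I_n | i != k])
      g i (X w ord0 i)); first by apply: measurable_prod => i _; exact: mgX.
  by apply/funext => w; rewrite big_filter.
have f0 w : 0 <= f w by apply: prodr_ge0 => i _; exact: g0.
pose c i := (\int[gam]_x (g i x)%:E)%E.
have c0 i : (0 <= c i)%E by apply: integral_ge0 => x _; rewrite lee_fin.
pose K := (\prod_(i | i != k) c i)%E.
have Kfin : K \is a fin_num.
  by rewrite /K; apply: prode_fin_num => i _; rewrite ge0_fin_numE//; exact: goo.
have K0 : 0 <= fine K by apply: fine_ge0; rewrite /K; apply: prode_ge0.
have mXk : measurable_fun setT (fun w => X w ord0 k : measurableTypeR R) := mX k.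
pose Xk : {mfun T >-> measurableTypeR R} :=
  HB.pack (fun w => X w ord0 k) (isMeasurableFun.Build _ _ _ _ _ mXk).
(* The law of coordinate [k] when [P] is weighted by all other factors. The induction hypothesis,
   with an indicator in place of factor [k], identifies it as [K] times the standard normal law,
   against which [g k] can then be integrated. *)
pose nu := pushforward (density_measure P mf f0) Xk.
have nuE A : measurable A -> nu A = mscale (NngNum K0) gam A.
  move=> mA; rewrite /nu /pushforward /density_measure /mscale/=.
  pose g' i := if i == k then \1_A : R -> R else g i.
  have g'k i : i != k -> g' i = g i by rewrite /g' => /negbTE ->.
  have g'kk : g' k = \1_A by rewrite /g' eqxx.
  have E : (\int[P]_w (\prod_i g' i (X w ord0 i))%:E =
      \prod_i \int[gam]_x (g' i x)%:E)%E.
    apply: (IH (fun i => if i == k then A else B i)).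
    - by move=> i; case: ifP.
    - by move=> i; rewrite /g'; case: ifP => // _; exact: measurable_indic.
    - by move=> i x; rewrite /g'; case: ifP => // _; rewrite indicE.
    - move=> i; rewrite /g'; case: ifP => // _; rewrite integral_normal_indic//.
      by rewrite (le_lt_trans (probability_le1 _ _)) ?ltry.
    - move=> i mi; rewrite /g'; case: eqVneq => // ik; apply: gB.
      by rewrite ltn_neqAle mi andbT eq_sym.
  transitivity (\int[P]_w (\prod_i g' i (X w ord0 i))%:E)%E.
    rewrite [LHS]integral_mkcond; apply: eq_integral => w _.
    rewrite patchE (bigD1 k)//= g'kk indicE.
    rewrite [_ \in A](_ : _ = (w \in Xk @^-1` A)); last first.
      by apply/idP/idP; rewrite !inE.
    rewrite (eq_bigr _ (fun i ik => congr1 (@^~ _) (g'k i ik))) -/(f w).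
    by case: ifP => _; rewrite ?mul1r ?mul0r.
  rewrite E (bigD1 k)//= g'kk integral_normal_indic// fineK// muleC.
  by congr (_ * _)%E; apply: eq_bigr => i ik; rewrite g'k.
transitivity (\int[nu]_x (g k x)%:E)%E.
  have := @ge0_integral_pushforward _ _ _ _ R _ mXk (density_measure P mf f0)
    setT _ measurableT mgk.
  move=> ->; last by move=> x _; rewrite lee_fin.
  rewrite preimage_setT ge0_integral_density//; last 2 first.
  - by apply/measurable_EFinP; exact: mgX.
  - by move=> w; rewrite lee_fin.
  by apply: eq_integral => w _; rewrite (bigD1 k)//= EFinM.
transitivity (\int[mscale (NngNum K0) gam]_x (g k x)%:E)%E.
  by apply: eq_measure_integral => A mA _; exact: nuE.
rewrite ge0_integral_mscale//; last by move=> x _; rewrite lee_fin.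
by rewrite /= fineK// [RHS](bigD1 k)//= muleC.
Qed.

Lemma integral_expR_sqr_enorm (s : R) : s < 1 ->
  (\int[P]_w (expR (s / 2 * enorm (X w) ^+ 2))%:E =
   ((Num.sqrt (1 - s))^-1 ^+ n)%:E)%E.
Proof.
move=> s1.
pose g (i : 'I_n) (x : R) := expR (s / 2 * x ^+ 2).
transitivity (\int[P]_w (\prod_i g i (X w ord0 i))%:E)%E.
  apply: eq_integral => w _; rewrite sqr_enorm mulr_sumr expR_sum.
  by congr EFin; apply: eq_bigr => i _; rewrite /g expr2.
rewrite ge0_integral_gaussian_prod.
- under eq_bigr do rewrite integral_expR_normal_prob//.
  by rewrite prodEFin prodr_const card_ord.
- move=> i; apply: measurableT_comp => //.
  by apply: measurable_funM => //; exact: measurable_funX.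
- by move=> i x; exact: expR_ge0.
- by move=> i; rewrite integral_expR_normal_prob// ltry.
Qed.
End gaussian_product.

(** * Beta integrals *)

Lemma measurable_invr (R : realType) : measurable_fun setT (fun x : R => x^-1).
Proof.
(* The square makes the base of the power non-negative; at 0 both sides are 0. *)
rewrite (_ : (fun x => _) = fun x => x * (x ^+ 2) `^ (-1)).
  apply: measurable_funM => //.
  by apply: (measurableT_comp (measurable_powR _)); exact: measurable_funX.
apply/funext => x; rewrite powR_inv1 ?sqr_ge0//.
have [->|x0] := eqVneq x 0; first by rewrite invr0 mul0r.
by rewrite expr2 invfM mulrA mulfV// mul1r.
Qed.

Lemma continuous_powR (R : realType) (p x : R) : 0 < x ->
  {for x, continuous (fun u : R => u `^ p)}.
Proof.
move=> x0; apply: differentiable_continuous; apply/derivable1_diffP.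
by have [] := is_derive1_powR p x0.
Qed.

Section beta_integrals.
Context {R : realType}.
Local Notation mu := (@lebesgue_measure R).
Implicit Types (a b t : R) (F f g : R -> R).

Lemma is_derive_continuous F f a b :
  (forall t, a < t < b -> is_derive t 1 F (f t)) ->
  forall t, a < t < b -> {for t, continuous F}.
Proof.
move=> dF t tab; apply: differentiable_continuous; apply/derivable1_diffP.
by have [] := dF t tab.
Qed.

Lemma is_derive_oo_LRcontinuous F f a b c e :
  (forall t, a < t < b -> is_derive t 1 F (f t)) -> a < c -> c < e -> e < b ->
  derivable_oo_LRcontinuous F c e.
Proof.
move=> dF ac ce eb; split.
- move=> t; rewrite in_itv/= => /andP[ct te].
  by have /dF[] : a < t < b by rewrite (lt_trans ac ct) (lt_trans te eb).
- apply: cvg_at_right_filter; apply: (is_derive_continuous dF).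
  by rewrite ac (lt_trans ce).
- apply: cvg_at_left_filter; apply: (is_derive_continuous dF).
  by rewrite eb (lt_trans ac).
Qed.

(** Smoothness is asked on an open interval around the compact one, which supplies the one-sided
    limits at [c] and [e]. *)
Lemma integral_subst_C1 F f g a b c e :
  (forall t, a < t < b -> is_derive t 1 F (f t)) ->
  (forall t, a < t < b -> {for t, continuous f}) ->
  {in `]a, b[ &, {homo F : x y / x < y}} ->
  a < c -> c < e -> e < b ->
  {within `[F c, F e], continuous g} ->
  (\int[mu]_(t in `[F c, F e]) (g t)%:E =
   \int[mu]_(t in `[c, e]) (g (F t) * f t)%:E)%E.
Proof.
move=> dF cf incF ac ce eb cg.
have F'E t : a < t < b -> F^`()%classic t = f t.
  by move=> tab; rewrite derive1E; have [_ ->] := dF t tab.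
have sub t : t \in `[c, e] -> a < t < b.
  rewrite in_itv/= => /andP[ct te].
  by rewrite (lt_le_trans ac ct) (le_lt_trans te eb).
have cF' t : a < t < b -> {for t, continuous F^`()%classic}.
  move=> tab; have cft : f z @[z --> t] --> f t := cf t tab.
  rewrite /prop_for /continuous_at F'E//; apply: cvg_trans cft.
  apply: near_eq_cvg; near=> z; rewrite F'E//.
  near: z; have : t \in `]a, b[ by rewrite in_itv.
  by move/near_in_itvoo; apply: filterS => z; rewrite in_itv.
rewrite integration_by_substitution_increasing//.
- apply: eq_integral => t; rewrite inE/= => tce; congr EFin.
  by rewrite !fctE F'E//; exact: sub.
- exact: ltW.
- move=> x y xce yce; apply: incF; rewrite in_itv/=; exact: sub.
- by move=> t tce; apply: cF'; apply: sub; exact: subset_itv_oo_cc tce.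
- apply/cvg_ex; exists (F^`()%classic c); apply: cvg_at_right_filter.
  by apply: cF'; apply: sub; rewrite in_itv/= lexx ltW.
- apply/cvg_ex; exists (F^`()%classic e); apply: cvg_at_left_filter.
  by apply: cF'; apply: sub; rewrite in_itv/= lexx ltW.
- exact: is_derive_oo_LRcontinuous dF ac ce eb.
Unshelve. all: by end_near. Qed.

Lemma cvg_integral_exhaust01 (c e : nat -> R) (g : R -> R) :
  {homo c : m k / (m <= k)%N >-> k <= m} ->
  {homo e : m k / (m <= k)%N >-> m <= k} ->
  (forall m, 0 < c m) -> (forall m, e m < 1) ->
  (forall t, 0 < t < 1 -> exists m, c m <= t <= e m) ->
  measurable_fun setT g -> (forall t, 0 <= g t) ->
  (\int[mu]_(t in `[c m, e m]) (g t)%:E)%E @[m --> \oo] -->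
  (\int[mu]_(t in `]0%R, 1%R[) (g t)%:E)%E.
Proof.
move=> dc ie c0 e1 cov mg g0.
have -> : `]0%R, 1%R[%classic = \bigcup_m `[c m, e m]%classic.
  apply/seteqP; split => t /=.
    by rewrite in_itv/= => /cov[m mt]; exists m => //=; rewrite in_itv.
  move=> [m _ /=]; rewrite !in_itv/= => /andP[ct te].
  by rewrite (lt_le_trans (c0 m) ct) (le_lt_trans te (e1 m)).
apply: ge0_nondecreasing_set_cvg_integral => //.
- move=> m k mk; rewrite subsetEset; apply: subset_itv; rewrite bnd_simp.
    exact: dc.
  exact: ie.
- by move=> m; apply/measurable_EFinP; exact: measurable_funTS.
- by move=> m t _; rewrite lee_fin.
Qed.

(** The offset 3 keeps [eps m] at most 1/3, so that the interval from [eps m] to [1 - eps m] is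
    non-degenerate already for [m = 0]. *)
Let eps (m : nat) : R := m.+3%:R^-1.

Let eps_gt0 m : 0 < eps m. Proof. by rewrite invr_gt0. Qed.

Let eps_lt m : eps m < 1 - eps m.
Proof.
have : eps m <= 3^-1 by rewrite lef_pV2 ?posrE// ler_nat.
by lra.
Qed.

Let eps_le m k : (m <= k)%N -> eps k <= eps m.
Proof. by move=> mk; rewrite lef_pV2 ?posrE// ler_nat !ltnS. Qed.

Let eps_cover t : 0 < t < 1 -> exists m, eps m <= t <= 1 - eps m.
Proof.
move=> /andP[t0 t1].
have [m mt] : exists m, eps m < Num.min t (1 - t).
  have u0 : 0 < Num.min t (1 - t) by rewrite lt_min t0 subr_gt0.
  exists (Num.truncn (Num.min t (1 - t))^-1).
  rewrite invf_plt ?posrE//.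
  have := truncnS_gt (Num.min t (1 - t))^-1; move/lt_trans; apply.
  by rewrite ltr_nat ltnS ltnW.
exists m; move: mt; rewrite lt_min => /andP[mt m1].
by rewrite ltW//=; lra.
Qed.

(** Beta weights can be unbounded at 0 and 1, so the substitution is made on compact intervals that
    exhaust the open one. Both sides are limits of the same sequence of integrals. *)
Lemma ge0_integral_subst01 F f g :
  (forall t, 0 < t < 1 -> is_derive t 1 F (f t)) ->
  (forall t, 0 < t < 1 -> {for t, continuous f}) ->
  {in `]0, 1[ &, {homo F : x y / x < y}} ->
  (forall t, 0 < t < 1 -> 0 < F t < 1) ->
  (forall t, 0 < t < 1 -> exists2 u, 0 < u < 1 & F u = t) ->
  (forall t, 0 < t < 1 -> {for t, continuous g}) ->
  measurable_fun setT g -> (forall t, 0 <= g t) ->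
  measurable_fun setT (fun t => g (F t) * f t) ->
  (forall t, 0 <= f t) ->
  (\int[mu]_(t in `]0%R, 1%R[) (g t)%:E =
   \int[mu]_(t in `]0%R, 1%R[) (g (F t) * f t)%:E)%E.
Proof.
move=> dF cf incF F01 surF cg mg g0 mgF f0.
have ineps m t : eps m <= t <= 1 - eps m -> 0 < t < 1.
  by have := eps_gt0 m; lra.
have e01 m : 0 < eps m < 1 by apply: (ineps m); have := eps_lt m; lra.
have e01' m : 0 < 1 - eps m < 1 by have := e01 m; lra.
have leF t u : 0 < t < 1 -> 0 < u < 1 -> t <= u -> F t <= F u.
  move=> t01 u01; rewrite le_eqVlt => /predU1P[->//|tu].
  by apply: ltW; apply: incF; rewrite ?in_itv.
have h1 := @cvg_integral_exhaust01 eps (fun m => 1 - eps m)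
  (fun t => g (F t) * f t).
have h2 := @cvg_integral_exhaust01 (F \o eps) (fun m => F (1 - eps m)) g.
have H2 : (\int[mu]_(t in `[F (eps m), F (1 - eps m)%R]) (g t)%:E)%E @[m --> \oo]
    --> (\int[mu]_(t in `]0%R, 1%R[) (g t)%:E)%E.
  apply: h2 => //.
  + by move=> m k mk; apply: leF => //; exact: eps_le.
  + by move=> m k mk; apply: leF => //; rewrite lerD2l lerN2 eps_le.
  + by move=> m; have /andP[] := F01 _ (e01 m).
  + by move=> m; have /andP[] := F01 _ (e01' m).
  + move=> t /surF[u u01 <-]; have [m /andP[mu um]] := eps_cover u01.
    by exists m; rewrite /= !leF.
have H3 : (\int[mu]_(t in `[F (eps m), F (1 - eps m)%R]) (g t)%:E)%E @[m --> \oo]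
    --> (\int[mu]_(t in `]0%R, 1%R[) (g (F t) * f t)%:E)%E.
  rewrite (_ : (fun m => _) = fun m => (\int[mu]_(t in `[eps m, (1 - eps m)%R])
    (g (F t) * f t)%:E)%E); last first.
    apply/funext => m; apply: (@integral_subst_C1 F f g 0 1) => //.
    - by have := e01' m; lra.
    - apply: continuous_in_subspaceT => t; rewrite inE/= in_itv/= => tF.
      apply: cg; have := F01 _ (e01 m); have := F01 _ (e01' m).
      by move: tF; lra.
  apply: h1 => //.
  - by move=> m k mk; rewrite lerD2l lerN2 eps_le.
  - by move=> m; have := e01' m; lra.
  - by move=> t; rewrite mulr_ge0.
exact: cvg_unique H2 H3.
Qed.

Lemma measurable_beta_weight a b : measurable_fun setT (beta_weight a b).
Proof.
apply: measurable_funM; first exact: measurable_powR.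
apply: (measurableT_comp (measurable_powR _)).
exact: measurable_funB.
Qed.

Lemma beta_weight_ge0 a b t : 0 <= beta_weight a b t.
Proof. by rewrite mulr_ge0 ?powR_ge0. Qed.

Lemma continuous_beta_weight a b t : 0 < t < 1 ->
  {for t, continuous (beta_weight a b)}.
Proof.
move=> /andP[t0 t1].
apply: cvgM; first exact: continuous_powR.
apply: (@continuous_comp _ _ _ (fun u : R => 1 - u) (fun u => u `^ (b - 1))).
  by apply: (@cvgB _ R^o); [exact: cvg_cst|exact: cvg_id].
by apply: continuous_powR; rewrite subr_gt0.
Qed.

(** With q(t) = t + (1 - t) rho and F = t / q one has 1 - F = (1 - t) rho / q and F' = rho / q^2.
    The powers of q collect to exactly -(a + b), those of rho to b. *)
Lemma integral_beta_weight_moebius a b (rho : R) : 0 < rho ->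
  (\int[mu]_(t in `]0%R, 1%R[)
     (beta_weight a b t * (t + (1 - t) * rho) `^ (- (a + b)))%:E =
   (rho `^ (- b))%:E * \int[mu]_(t in `]0%R, 1%R[) (beta_weight a b t)%:E)%E.
Proof.
move=> rho0; pose q (t : R) := t + (1 - t) * rho.
pose F (t : R) := t / q t; pose f (t : R) := rho / q t ^+ 2.
have q0 t : 0 < t < 1 -> 0 < q t.
  by move=> /andP[t0 t1]; rewrite addr_gt0// mulr_gt0// subr_gt0.
have dq t : is_derive t 1 q (1 - rho).
  rewrite (_ : q = (fun t => t + (1 - t) * rho))//.
  by apply: is_derive_eq; rewrite /GRing.scale/=; ring.
have mq : measurable_fun setT q.
  by apply: measurable_funD => //; apply: measurable_funM => //;
    exact: measurable_funB.
have dF t : 0 < t < 1 -> is_derive t 1 F (f t).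
  move=> t01; have qt0 := q0 t t01.
  have := @is_deriveV _ q t (1 - rho) 1 (lt0r_neq0 qt0) (dq t) => dqV.
  rewrite (_ : F = id * (fun y => (q y)^-1)) //.
  apply: is_derive_eq; rewrite /GRing.scale/= /f /q; field.
  by rewrite -/(q t) gt_eqF.
have cq t : {for t, continuous q}.
  by apply: differentiable_continuous; apply/derivable1_diffP; have [] := dq t.
have cf t : 0 < t < 1 -> {for t, continuous f}.
  move=> t01; apply: cvgM; first exact: cvg_cst.
  apply: cvgV; first by rewrite expf_neq0// gt_eqF// q0.
  exact: (cvgM (cq t) (cq t)).
have incF : {in `]0, 1[ &, {homo F : x y / x < y}}.
  move=> x y; rewrite !in_itv/= => x01 y01 xy.
  rewrite /F ltr_pdivrMr ?q0// mulrAC ltr_pdivlMr ?q0// /q.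
  by nra.
have F01 t : 0 < t < 1 -> 0 < F t < 1.
  move=> t01; have t0 : 0 < t by case/andP: t01.
  rewrite divr_gt0 ?q0//= ltr_pdivrMr ?q0// mul1r ltrDl mulr_gt0// subr_gt0.
  by case/andP: t01.
have surF t : 0 < t < 1 -> exists2 u, 0 < u < 1 & F u = t.
  move=> /andP[t0 t1]; have D0 : 0 < t + (1 - t) / rho.
    by rewrite addr_gt0// divr_gt0// subr_gt0.
  (* The inverse map has the same form, with rho replaced by its inverse. *)
  exists (t / (t + (1 - t) / rho)).
    rewrite divr_gt0//= ltr_pdivrMr// mul1r ltrDl divr_gt0// subr_gt0//.
  rewrite /F /q; field; rewrite (gt_eqF rho0) /=.
  have -> : t * rho + (1 - t) = rho * (t + (1 - t) / rho).
    by field; rewrite gt_eqF.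
  by rewrite gt_eqF ?mulr_gt0.
have gF t : 0 < t < 1 -> beta_weight a b (F t) * f t =
    rho `^ b * (beta_weight a b t * q t `^ (- (a + b))).
  move=> t01; have qt := q0 t t01; have /andP[t0 t1] := t01.
  have pE (x c : R) : 0 < x -> x `^ c = expR (c * ln x).
    by move=> x0; rewrite /powR gt_eqF.
  have t1' : 0 < 1 - t by rewrite subr_gt0.
  have F1 : 1 - F t = (1 - t) * rho / q t.
    by rewrite /F /q; field; rewrite -/(q t) gt_eqF.
  have lnq : ln (q t)^-1 = - ln (q t) by rewrite lnV.
  have fE : f t = expR (ln rho - 2 * ln (q t)).
    by rewrite expRB expRM_natl !lnK.
  rewrite /beta_weight F1 /F fE !pE ?divr_gt0 ?mulr_gt0//.
  rewrite !lnM ?posrE ?mulr_gt0 ?invr_gt0// lnq -!expRD; congr expR.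
  by ring.
have f0 t : 0 <= f t by rewrite divr_ge0 ?sqr_ge0 ?ltW.
have mw := measurable_beta_weight a b.
have mgF : measurable_fun setT (fun t => beta_weight a b (F t) * f t).
  have mqV := measurableT_comp (@measurable_invr R) mq.
  apply: measurable_funM.
    by apply: (measurableT_comp mw); exact: measurable_funM.
  apply: measurable_funM => //; rewrite (_ : (fun t => _) = fun t => (q t)^-1 ^+ 2).
    exact: measurable_funX.
  by apply/funext => t; rewrite exprVn.
rewrite (@ge0_integral_subst01 F f)//; last 2 first.
  exact: continuous_beta_weight.
  exact: beta_weight_ge0.
rewrite -ge0_integralZl//.
- apply: eq_integral => t; rewrite inE/= in_itv/= => t01.
  rewrite gF// -EFinM; congr EFin; rewrite [RHS]mulrA -powRD ?addNr ?powRr0 ?mul1r//.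
  by rewrite (gt_eqF rho0) implybT.
- by apply/measurable_EFinP/measurable_funTS.
- by move=> t _; rewrite lee_fin mulr_ge0// beta_weight_ge0.
- by rewrite lee_fin powR_ge0.
Qed.

(** The worst case is a = b = 1/2, where the weight is x y with x = t^(-1/2) and y = (1 - t)^(-1/2).
    Since 1/t + 1/(1 - t) = 1/(t (1 - t)), the product x y is the square root of x^2 + y^2, hence at
    most x + y. *)
Lemma beta_weight_le a b t : 2^-1 <= a -> 2^-1 <= b -> 0 < t < 1 ->
  beta_weight a b t <= t `^ (2^-1 - 1) + (1 - t) `^ (2^-1 - 1).
Proof.
move=> a2 b2 /andP[t0 t1]; have t1' : 0 < 1 - t by rewrite subr_gt0.
pose x := t `^ (2^-1 - 1); pose y := (1 - t) `^ (2^-1 - 1).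
have x0 : 0 < x by exact: powR_gt0.
have y0 : 0 < y by exact: powR_gt0.
have sqrV (u : R) : 0 < u -> u * (u `^ (2^-1 - 1)) ^+ 2 = 1.
  move=> u0; rewrite expr2 -powRD; last by rewrite (gt_eqF u0) implybT.
  rewrite (_ : 2^-1 - 1 + (2^-1 - 1) = -1); last by field.
  by rewrite powR_inv1 ?ltW// mulfV// gt_eqF.
have xE := sqrV _ t0; have yE := sqrV _ t1'.
have xy2 : x ^+ 2 + y ^+ 2 = x ^+ 2 * y ^+ 2.
  have -> : x ^+ 2 * y ^+ 2 = y ^+ 2 * (t * x ^+ 2) + x ^+ 2 * ((1 - t) * y ^+ 2).
    by ring.
  by rewrite xE yE !mulr1 addrC.
apply: (@le_trans _ _ (x * y)).
  rewrite /beta_weight ler_pM ?powR_ge0//.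
    by apply: ger_powR; [rewrite t0 ltW|rewrite lerD2r].
  by apply: ger_powR; [rewrite t1' gerBl ltW|rewrite lerD2r].
have xy0 : 0 <= x * y by rewrite mulr_ge0// ltW.
have xDy0 : 0 <= x + y by rewrite addr_ge0// ltW.
rewrite -(@ler_pXn2r _ 2)//.
by rewrite exprMn -xy2 sqrrD lerD2r lerDl mulrn_wge0// mulr_ge0 ltW.
Qed.

Lemma integral_beta_weight_lty a b : 2^-1 <= a -> 2^-1 <= b ->
  (\int[mu]_(t in `]0%R, 1%R[) (beta_weight a b t)%:E < +oo)%E.
Proof.
move=> a2 b2.
pose phi (t : R) := t `^ (2^-1 - 1) + (1 - t) `^ (2^-1 - 1).
(* A primitive of [phi]; it rises from -2 to 2 on the unit interval, whence the bound 4 below. *)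
pose Phi (t : R) := 2 * t `^ (2^-1) - 2 * (1 - t) `^ (2^-1).
have mphi : measurable_fun setT phi.
  apply: measurable_funD; first exact: measurable_powR.
  apply: (measurableT_comp (measurable_powR _)).
  exact: measurable_funB.
have phi0 t : 0 <= phi t by rewrite addr_ge0// powR_ge0.
have dPhi t : 0 < t < 1 -> is_derive t 1 Phi (phi t).
  move=> /andP[t0 t1]; have t1' : 0 < 1 - t by rewrite subr_gt0.
  have d1 := is_derive1_powR (2^-1) t0.
  have d2 : is_derive t 1 ((fun u => u `^ (2^-1)) \o (fun t => 1 - t))
      (2^-1 * (1 - t) `^ (2^-1 - 1) * (-1)).
    apply: is_derive1_comp; first exact: is_derive1_powR.
    by apply: is_derive_eq; ring.
  rewrite (_ : Phi = (2 \*: (fun u => u `^ (2^-1))) -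
     (2 \*: ((fun u => u `^ (2^-1)) \o (fun t => 1 - t)))) //.
  by apply: is_derive_eq; rewrite /GRing.scale/= /phi; field.
have bnd m : (\int[mu]_(t in `[eps m, (1 - eps m)%R]) (phi t)%:E <= 4%:E)%E.
  have e0 := eps_gt0 m; have e1 := eps_lt m.
  have sub t : eps m <= t <= 1 - eps m -> 0 < t < 1 by lra.
  rewrite (@continuous_FTC2 _ phi Phi)//.
  - rewrite -EFinB lee_fin.
    have p1 (u : R) : 0 <= u <= 1 -> 0 <= u `^ 2^-1 <= 1.
      move=> /andP[u0 u1]; rewrite powR_ge0/=.
      have h : (1 : R) `^ 2^-1 = 1 by rewrite powR1.
      by rewrite -[leRHS]h ge0_ler_powR ?nnegrE ?invr_ge0.
    have /p1/andP[A1 A2] : 0 <= eps m <= 1 by lra.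
    have /p1/andP[B1 B2] : 0 <= 1 - eps m <= 1 by lra.
    rewrite /Phi (_ : 1 - (1 - eps m) = eps m); last by ring.
    by lra.
  - apply: continuous_in_subspaceT => t; rewrite inE/= in_itv/= => /sub t01.
    apply: cvgD; first by apply: continuous_powR; case/andP: t01.
    apply: (@continuous_comp _ _ _ (fun u : R => 1 - u) (fun u => u `^ _)).
      by apply: (@cvgB _ R^o); [exact: cvg_cst|exact: cvg_id].
    by apply: continuous_powR; rewrite subr_gt0; case/andP: t01.
  - by apply: (is_derive_oo_LRcontinuous dPhi) => //; lra.
  - move=> t; rewrite in_itv/= => /andP[t0 t1]; rewrite derive1E.
    by have /dPhi[_ ->] : 0 < t < 1 by apply: sub; rewrite !ltW.
have cv := @cvg_integral_exhaust01 eps (fun m => 1 - eps m) phi.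
apply: (@le_lt_trans _ _ (\int[mu]_(t in `]0%R, 1%R[) (phi t)%:E)%E).
  apply: ge0_le_integral => //.
  - by move=> t _; rewrite lee_fin beta_weight_ge0.
  - by apply/measurable_EFinP/measurable_funTS; exact: measurable_beta_weight.
  - by apply/measurable_EFinP/measurable_funTS.
  - by move=> t /=; rewrite in_itv/= lee_fin => t01; exact: beta_weight_le.
apply: (@le_lt_trans _ _ 4%:E); last exact: ltry.
have {}cv : (\int[mu]_(t in `[eps m, (1 - eps m)%R]) (phi t)%:E)%E @[m --> \oo]
    --> (\int[mu]_(t in `]0%R, 1%R[) (phi t)%:E)%E.
  apply: cv => //.
  - by move=> m k mk; rewrite lerD2l lerN2 eps_le.
  - by move=> m; have := eps_gt0 m; lra.
rewrite -(cvg_lim _ cv)//; apply: lime_le; first by apply/cvg_ex; eexists; exact: cv.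
by apply: nearW => m; exact: bnd.
Qed.

(** A zero integral would force the weight to vanish almost everywhere, but it is positive on the
    whole interval. *)
Lemma integral_beta_weight_gt0 a b :
  (0 < \int[mu]_(t in `]0%R, 1%R[) (beta_weight a b t)%:E)%E.
Proof.
rewrite lt0e; apply/andP; split; last first.
  by apply: integral_ge0 => t _; rewrite lee_fin beta_weight_ge0.
apply/negP => /eqP I0.
pose D : set (measurableTypeR R) := `]0%R, 1%R[%classic.
have mD : measurable D by exact: measurable_itv.
have mw : measurable_fun D (fun t => (beta_weight a b t)%:E).
  by apply/measurable_EFinP/measurable_funTS; exact: measurable_beta_weight.
have := (ae_eq_integral_abs mu mD mw).1.
under eq_integral do rewrite gee0_abs ?lee_fin ?beta_weight_ge0//.
move=> /(_ I0)[N [mN N0 subN]].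
have : (mu D <= mu N)%E.
  apply: le_measure; rewrite ?inE// => t Dt.
  have /andP[t0 t1] : 0 < t < 1 by move: Dt; rewrite /D/= in_itv.
  apply: subN => /= /(_ Dt)/eqP.
  have t1' : 0 < 1 - t by rewrite subr_gt0.
  by rewrite eqe mulf_eq0 !powR_eq0 (gt_eqF t0) (gt_eqF t1').
by rewrite N0 lebesgue_measure_itv/= lte01 oppr0 adde0 leNgt lte01.
Qed.

End beta_integrals.

(** * The components of the mixture and their integrals *)

Section beta_measure.
Context {R : realType}.
Local Notation mu := (@lebesgue_measure R).

(* The value at dist^2 = t of E exp((1 - r^-2)/2 |N|^2 (1 - t)). *)
Definition chi2_mgf (n : nat) (r t : R) : R :=
  \1_`[0, 1]%classic t * (t + (1 - t) * r ^- 2) `^ (- (n%:R / 2)).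

Lemma chi2_mgf_ge0 n r t : 0 <= chi2_mgf n r t.
Proof. by rewrite mulr_ge0// powR_ge0. Qed.

Lemma measurable_chi2_mgf n r : measurable_fun setT (chi2_mgf n r).
Proof.
apply: measurable_funM; first exact: measurable_indic.
apply: (measurableT_comp (measurable_powR _)).
apply: measurable_funD => //; apply: measurable_funM => //.
exact: measurable_funB.
Qed.

Lemma powR_invsqr (r : R) k : 0 < r -> (r ^- 2) `^ (- (k%:R / 2)) = r ^+ k.
Proof.
move=> r0; rewrite -powR_invn ?ltW// -powRrM -powR_mulrn ?ltW//.
by congr (_ `^ _); field.
Qed.

(** Realises each distribution function by a measure, so that the identity for the distribution
    function of D can be integrated. *)
Lemma beta_kn_measure n k : (0 < n)%N -> (k <= n)%N ->
  exists m : {measure set (measurableTypeR R) -> \bar R},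
  [/\ (m setT < +oo)%E, forall t : R, m `]-oo, t]%classic = (beta_kn n k t)%:E &
    forall r : R, 0 < r -> (\int[m]_t (chi2_mgf n r t)%:E = (r ^+ k)%:E)%E].
Proof.
move=> n0 kn; rewrite /beta_kn; have [->|k0] := eqVneq k 0%N.
  exists (dirac (1 : measurableTypeR R)); split.
  - by rewrite /= diracT ltry.
  - by move=> t; rewrite /= /dirac indicE mem_setE in_itv.
  - move=> r r0; rewrite integral_dirac//; last first.
      by apply/measurable_EFinP; exact: measurable_chi2_mgf.
    rewrite diracT mul1e /chi2_mgf indicE mem_set; last first.
      by rewrite /= in_itv/= ler01 lexx.
    by rewrite subrr mul0r addr0 powR1 mulr1 expr0.
(* The unit mass at 0: there [chi2_mgf] is r^-2 raised to -n/2, that is r^n. *)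
have [->|kn'] := eqVneq k n.
  exists (dirac (0 : measurableTypeR R)); split.
  - by rewrite /= diracT ltry.
  - by move=> t; rewrite /= /dirac indicE mem_setE in_itv.
  - move=> r r0; rewrite integral_dirac//; last first.
      by apply/measurable_EFinP; exact: measurable_chi2_mgf.
    rewrite diracT mul1e /chi2_mgf indicE mem_set; last first.
      by rewrite /= in_itv/= ler01 lexx.
    by rewrite subr0 add0r !mul1r powR_invsqr.
have {kn kn'}kn : (k < n)%N by rewrite ltn_neqAle kn'.
set a : R := (n - k)%:R / 2; set b : R := k%:R / 2.
(* As 0 < k < n, both half-integer parameters are at least 1/2, which is what integrability was
   shown for. *)
have a2 : 2^-1 <= a by rewrite ler_pdivlMr// mulVf// ler1n subn_gt0.
have b2 : 2^-1 <= b by rewrite ler_pdivlMr// mulVf// ler1n lt0n.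
have ab : a + b = n%:R / 2 by rewrite -mulrDl -natrD subnK// ltnW.
pose B := (\int[mu]_(t in `]0%R, 1%R[) (beta_weight a b t)%:E)%E.
have Boo : (B < +oo)%E by exact: integral_beta_weight_lty.
have B0 : (0 < B)%E by exact: integral_beta_weight_gt0.
have Bfin : B \is a fin_num by rewrite ge0_fin_numE// ltW.
have B0' : 0 < fine B by rewrite fine_gt0// B0.
pose f (t : R) := \1_`]0, 1[%classic t * beta_weight a b t / fine B.
have mw := measurable_beta_weight a b.
have mI : measurable_fun setT (\1_`]0, 1[%classic : R -> R).
  exact: measurable_indic.
have mf : measurable_fun setT f by apply: measurable_funM => //; exact: measurable_funM.
have f0 t : 0 <= f t.
  by rewrite divr_ge0 ?(ltW B0')// mulr_ge0// beta_weight_ge0.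
have fI (g : R -> R) (D : set R) : measurable D -> measurable_fun setT g ->
    (forall t, 0 <= g t) ->
    (\int[mu]_(t in D) (g t * f t)%:E =
     \int[mu]_(t in `]0%R, 1%R[ `&` D) (g t * beta_weight a b t)%:E * ((fine B)^-1)%:E)%E.
  move=> mD mg g0.
  rewrite -ge0_integralZr//.
  - rewrite integral_mkcondl; apply: eq_integral => t _; rewrite patchE.
    rewrite /f indicE; case: ifP => _; last by rewrite !mul0r mulr0.
    by rewrite mul1r mulrA EFinM.
  - exact: measurableI.
  - by apply/measurable_EFinP; apply: measurable_funTS; exact: measurable_funM.
  - by move=> t _; rewrite lee_fin mulr_ge0// beta_weight_ge0.
  - by rewrite lee_fin invr_ge0 ltW.
have m1 : measurable_fun setT (cst 1 : R -> R) by exact: measurable_cst.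
have fI1 (D : set R) : measurable D -> (\int[mu]_(t in D) (f t)%:E =
    \int[mu]_(t in `]0%R, 1%R[ `&` D) (beta_weight a b t)%:E * ((fine B)^-1)%:E)%E.
  move=> mD; under eq_integral do rewrite -[f _]mul1r.
  rewrite (fI (cst 1))//; congr (_ * _)%E.
  by apply: eq_integral => t _; rewrite mul1r.
exists (density_measure mu mf f0); split.
- rewrite /= /density_measure fI1// setIT -/B -(fineK Bfin) -EFinM.
  exact: ltry.
- move=> t; rewrite /= /density_measure fI1// /beta_cdf /Rintegral.
  rewrite EFinM fineK// ge0_fin_numE; last first.
    by apply: integral_ge0 => u _; rewrite lee_fin beta_weight_ge0.
  apply: le_lt_trans Boo; apply: ge0_subset_integral => //.
  + exact: measurableI.
  + exact/measurable_EFinP/measurable_funTS.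
  + by move=> u _; rewrite lee_fin beta_weight_ge0.
- move=> r r0; rewrite ge0_integral_density//; last 2 first.
  + by apply/measurable_EFinP; exact: measurable_chi2_mgf.
  + by move=> t; rewrite lee_fin chi2_mgf_ge0.
  under eq_integral do rewrite -EFinM.
  rewrite (fI (chi2_mgf n r))//; last 2 first.
  + exact: measurable_chi2_mgf.
  + exact: chi2_mgf_ge0.
  rewrite setIT (_ : (\int[mu]_(t in _) _)%E = ((r ^+ k)%:E * B)%E).
    rewrite -muleA (_ : (B * _)%E = 1%E) ?mule1//.
    by rewrite -[X in (X * _)%E](fineK Bfin) -EFinM mulfV ?gt_eqF.
  rewrite /B -(powR_invsqr k r0) -integral_beta_weight_moebius ?invr_gt0 ?exprn_gt0//.
  apply: eq_integral => t; rewrite inE/= in_itv/= => /andP[t0 t1].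
  rewrite /chi2_mgf indicE mem_set ?mul1r ?ab 1?mulrC//.
  by rewrite /= in_itv/= !ltW.
Qed.

End beta_measure.

(** * Uniformity on the sphere under conditioning *)

(** Normalising the restricted measure gives the conditional probability given [E]; the fallback to
    [P] in [mnormalize] is ruled out because the mass is finite and non-zero. *)
Lemma cond_probE (R : realType) d (T : measurableType d) (P : probability T R)
    (E : set T) (mE : measurable E) (A : set T) : P E != 0%E ->
  (mnormalize (mrestr P mE) P : probability T R) A =
  (P (A `&` E) * ((fine (P E))^-1)%:E)%E.
Proof.
move=> PE0; have ET : mrestr P mE setT = P E by rewrite /mrestr setTI.
transitivity (if (P E == 0) || (P E == +oo) then P A else
    (P (A `&` E) * ((fine (P E))^-1)%:E))%E.
  by rewrite -ET /= /mnormalize; case: ifP.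
by rewrite (negbTE PE0) /= lt_eqF// (le_lt_trans (probability_le1 P mE)) ?ltry.
Qed.

Section normalized_gaussian.
Context {R : realType} {n : nat} {d : measure_display} {T : measurableType d}
  {P : probability T R}.
Variable X : T -> 'rV[R]_n.
Hypothesis gX : gaussian_vector (P := P) X.
Hypothesis n0 : (0 < n)%N.

Let mX : measurable_coord X := gX.1.

(* The junk value [0^-1 = 0] makes this the zero vector at 0. *)
Definition normalize_vec (x : 'rV[R]_n) : 'rV[R]_n := (enorm x)^-1 *: x.

Lemma enorm_normalize_vec x : enorm (normalize_vec x) = (x != 0)%:R.
Proof.
rewrite enormZ ger0_norm ?invr_ge0 ?enorm_ge0//.
have [->|x0] := eqVneq x 0; first by rewrite enorm0 mulr0.
by rewrite mulVf// enorm_eq0.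
Qed.

Lemma measurable_normalize_vec d' (T' : measurableType d') (Y : T' -> 'rV[R]_n) :
  measurable_coord Y -> measurable_coord (normalize_vec \o Y).
Proof.
move=> mY i; rewrite (_ : (fun w => _) = fun w => (enorm (Y w))^-1 * Y w ord0 i).
  apply: measurable_funM; last exact: mY.
  by apply: (measurableT_comp (@measurable_invr R)); exact: measurable_enorm.
by apply/funext => w; rewrite mxE.
Qed.

Let zero_set_box : [set w | X w = 0] =
  [set w | forall i : 'I_n, [set (0 : R)] (X w ord0 i)].
Proof.
apply/seteqP; split => w /= h; first by move=> i; rewrite h mxE.
by apply/rowP => i; rewrite h mxE.
Qed.

Lemma gaussian_vector_eq0 : P [set w | X w = 0] = 0%E.
Proof.
have gam0 : normal_prob 0 1 [set (0 : R)] = 0%E by exact: integral_set1.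
rewrite zero_set_box (gX.2 (fun=> [set (0 : R)]))//.
by rewrite (bigD1 (Ordinal n0))//= gam0 mul0e.
Qed.

Lemma measurable_eq0 : measurable [set w | X w = 0].
Proof.
by rewrite zero_set_box; exact: (measurable_box (A := fun=> [set (0 : R)])).
Qed.

(** Packaged as measurable functions, so that the same family is a random vector under [P] and under
    each conditional probability. *)
Definition nvec (i : 'I_n) : {mfun T >-> R} :=
  HB.pack (fun w => normalize_vec (X w) ord0 i)
    (isMeasurableFun.Build _ _ _ _ _ (measurable_normalize_vec mX i)).

Lemma rvec_nvec (P' : probability T R) : rvec (P := P') nvec = normalize_vec \o X.
Proof. by apply/funext => w; apply/rowP => i; rewrite mxE. Qed.

Definition sqnorm (w : T) : R := enorm (X w) ^+ 2.

Lemma measurable_sqnorm : measurable_fun setT sqnorm.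
Proof. by apply: measurable_funX; exact: measurable_enorm. Qed.

(** Replacing [X] by [X *m Q] rotates the direction and leaves the norm, hence the conditioning
    event, unchanged; and the two vectors have the same law. *)
Lemma uniform_nvec_cond (B : set R) (mE : measurable (sqnorm @^-1` B)) :
  measurable B -> P (sqnorm @^-1` B) != 0%E ->
  uniform_on_sphere (P := mnormalize (mrestr P mE) P) nvec.
Proof.
move=> mB PB0; set E := sqnorm @^-1` B in mE PB0 *.
pose PB : probability T R := mnormalize (mrestr P mE) P.
have PE A : PB A = (P (A `&` E) * ((fine (P E))^-1)%:E)%E by exact: cond_probE.
have PEfin : P E \is a fin_num by exact: fin_num_measure.
rewrite -/PB; split.
  rewrite PE rvec_nvec.
  rewrite (_ : [set w | _] = ~` [set w | X w = 0]); last first.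
    apply/seteqP; split => w /=; rewrite enorm_normalize_vec.
      by move=> h X0; move: h; rewrite X0 eqxx => /esym/eqP; rewrite oner_eq0.
    by move=> /eqP ->.
  have -> : P (~` [set w | X w = 0] `&` E) = P E.
    rewrite setIC -setDE measureD//; last 2 first.
    - exact: measurable_eq0.
    - by rewrite (le_lt_trans (probability_le1 P mE)) ?ltry.
    rewrite [X in (_ - X)%E](_ : _ = 0%E) ?sube0//; apply/eqP; rewrite -measure_le0.
    rewrite -gaussian_vector_eq0; apply: le_measure; rewrite ?inE//.
    + by apply: measurableI => //; exact: measurable_eq0.
    + exact: measurable_eq0.
  by rewrite -{1}(fineK PEfin) -EFinM mulfV// fine_eq0.
move=> Q A QQ bA; rewrite !PE rvec_nvec; congr (_ * _)%E.
(* The joint event on direction and norm, written as one set of values of [X]. *)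
pose A' : set (@boxV R n) :=
  [set x : 'rV[R]_n | A (normalize_vec x) /\ B (enorm x ^+ 2)].
have mA' : measurable A'.
  apply: measurableI.
    apply: (preimage_borel_measurable _ bA).
    apply: (@measurable_normalize_vec _ boxV id); exact: boxV_coord.
  rewrite -[X in measurable X]setTI.
  by apply: (measurable_funX 2 (measurable_enorm (@boxV_coord R n))).
have gXQ := gaussian_orthogonal QQ gX.
have law := @eq_law_boxes R n _ T P (fun w => X w *m Q) X A' gXQ.1 mX _ mA'.
transitivity (P ((fun w => X w *m Q) @^-1` A')).
  congr (P _); apply/seteqP; split => w; rewrite /A' /= /normalize_vec
    enorm_mulmx_orthogonal// scalemxAl; exact.
by rewrite law// => C mC; rewrite gXQ.2// gX.2.
Qed.

Lemma measurable_dist_sqr (C : set 'rV[R]_n) : C !=set0 ->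
  measurable_fun setT (fun w => dist_to (normalize_vec (X w)) C ^+ 2).
Proof.
move=> C0; apply: measurable_funX; apply: measurable_dist_to => //.
exact: measurable_normalize_vec.
Qed.

Lemma nvec_sqnorm_indep (C : set 'rV[R]_n) (v : 'I_n.+1 -> R) :
  conic_intrinsic_volumes C v -> C !=set0 ->
  forall (B : set R) (t : R), measurable B ->
  P ([set w | dist_to (normalize_vec (X w)) C ^+ 2 <= t] `&` (sqnorm @^-1` B)) =
  (P (sqnorm @^-1` B) * (\sum_(k < n.+1) beta_kn n k t * v k)%:E)%E.
Proof.
move=> hv C0 B t mB.
have mE : measurable (sqnorm @^-1` B).
  by rewrite -[X in measurable X]setTI; exact: measurable_sqnorm.
(* A null event cannot be conditioned on, but both sides are then zero. *)
have [PE0|PE0] := eqVneq (P (sqnorm @^-1` B)) 0%E.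
  rewrite PE0 mul0e; apply/eqP; rewrite -measure_le0 -PE0.
  apply: le_measure; rewrite ?inE//; apply: measurableI => //.
  rewrite -[X in measurable X]setTI (_ : [set w | _] =
    (fun w => dist_to (normalize_vec (X w)) C ^+ 2) @^-1` `]-oo, t]).
    exact: measurable_dist_sqr.
  by apply/seteqP; split => w /=; rewrite in_itv.
have := hv _ _ _ _ (uniform_nvec_cond mE mB PE0) t.
rewrite rvec_nvec cond_probE// => h.
have PEfin : P (sqnorm @^-1` B) \is a fin_num by exact: fin_num_measure.
rewrite -h muleCA [X in (_ * X)%E](_ : _ = 1%E) ?mule1//.
by rewrite -{1}(fineK PEfin) -EFinM mulfV// fine_eq0.
Qed.

End normalized_gaussian.

(** * Expectation over the norm and the squared distance *)

Section expectation_formula.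
Context {R : realType} {n : nat} {d : measure_display} {T : measurableType d}
  {P : probability T R}.
Variables (X : T -> 'rV[R]_n) (C : set 'rV[R]_n) (v : 'I_n.+1 -> R) (r : R).
Hypotheses (gX : gaussian_vector (P := P) X) (n0 : (0 < n)%N).
Hypotheses (cC : convex_cone C) (hv : conic_intrinsic_volumes C v) (r0 : 0 < r).

Let C0 : C !=set0. Proof. by case: cC. Qed.
Let D (w : T) : R := dist_to (normalize_vec (X w)) C ^+ 2.
Let U : T -> R := sqnorm X.
Let mD : measurable_fun setT D. Proof. exact: (measurable_dist_sqr gX C0). Qed.
Let mU : measurable_fun setT U. Proof. exact: (measurable_sqnorm gX). Qed.

Let Dm : {mfun T >-> measurableTypeR R} :=
  HB.pack D (isMeasurableFun.Build _ _ T (measurableTypeR R) _ mD).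
Let Um : {mfun T >-> measurableTypeR R} :=
  HB.pack U (isMeasurableFun.Build _ _ T (measurableTypeR R) _ mU).

(** True also where [X] vanishes, since the normalised vector is then 0; so the indicator in
    [chi2_mgf] equals 1 at every [D w]. *)
Let D01 w : 0 <= D w <= 1.
Proof.
rewrite sqr_ge0/= expr_le1 ?dist_to_ge0//.
apply: (le_trans (dist_to_le_enorm _ cC)); rewrite enorm_normalize_vec.
by case: (_ != _); rewrite ?ler01.
Qed.

Let cdfD (t : R) : distribution P Dm `]-oo, t]%classic =
  (\sum_(k < n.+1) beta_kn n k t * v k)%:E.
Proof.
have := nvec_sqnorm_indep gX n0 hv C0 t (@measurableT _ R).
rewrite preimage_setT setIT probability_setT mul1e => <-.
by congr (P _); apply/seteqP; split => w /=; rewrite in_itv.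
Qed.

(** For fixed [B] both sides are finite measures in [A] that agree on half-lines. *)
Let joint (A B : set R) : measurable A -> measurable B ->
  P (U @^-1` B `&` D @^-1` A) = (distribution P Um B * distribution P Dm A)%E.
Proof.
move=> mA mB.
have mE : measurable (U @^-1` B).
  by rewrite -[X in measurable X]setTI; exact: mU.
have PEfin : P (U @^-1` B) \is a fin_num by exact: fin_num_measure.
have PE0 : 0 <= fine (P (U @^-1` B)) by rewrite fine_ge0.
have := @eq_finite_measure_itvNyc R
  (pushforward (mrestr P mE) Dm) (mscale (NngNum PE0) (distribution P Dm)).
move=> /(_ mD _ _ _ A mA) PA.
transitivity (pushforward (mrestr P mE) Dm A).
  by rewrite /pushforward /mrestr setIC.
rewrite PA //.
- by rewrite /= /mscale/= fineK.
- by rewrite /= /pushforward /mrestr preimage_setT setTI ltey_eq PEfin.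
- by rewrite /= /mscale/= probability_setT mule1 ltry.
- move=> t; transitivity (P (U @^-1` B) * distribution P Dm `]-oo, t]%classic)%E;
    last by rewrite /= /mscale/= fineK.
  rewrite cdfD.
  rewrite -(nvec_sqnorm_indep gX n0 hv C0 t mB).
  by congr (P (_ `&` _)); apply/seteqP; split => w /=; rewrite in_itv.
Qed.

Let integral_chi2 : (\int[P]_w (chi2_mgf n r (D w))%:E =
  (\sum_(k < n.+1) r ^+ k * v k)%:E)%E.
Proof.
have [m mP] := choice (fun k : 'I_n.+1 => @beta_kn_measure R n k n0 (ltn_ord k)).
have p0 k : 0 <= Num.max (v k) 0 by rewrite le_max lexx orbT.
have q0 k : 0 <= Num.max (- v k) 0 by rewrite le_max lexx orbT.
have pq k : v k = Num.max (v k) 0 - Num.max (- v k) 0.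
  by case: (leP (v k) 0) => vk; case: (leP (- v k) 0) => vk'; lra.
pose mp (j : nat) := mscale (NngNum (p0 (inord j))) (m (inord j)).
pose mq (j : nat) := mscale (NngNum (q0 (inord j))) (m (inord j)).
have mE (c : 'I_n.+1 -> R) (c0 : forall k, 0 <= c k) (t : R) :
    msum (fun j => mscale (NngNum (c0 (inord j))) (m (inord j))) n.+1
      `]-oo, t]%classic = (\sum_(k < n.+1) beta_kn n k t * c k)%:E.
  rewrite /msum -sumEFin; apply: eq_bigr => k _.
  transitivity ((c k)%:E * m k `]-oo, t]%classic)%E.
    by rewrite /= /mscale /= inord_val.
  by have [_ mk _] := mP k; rewrite mk -EFinM mulrC.
have mfin (c : 'I_n.+1 -> R) (c0 : forall k, 0 <= c k) :
    (msum (fun j => mscale (NngNum (c0 (inord j))) (m (inord j))) n.+1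
      setT < +oo)%E.
  rewrite /msum; apply: lte_sum_pinfty => k _; rewrite /mscale /= inord_val.
  by have [mk _ _] := mP k; rewrite lte_mul_pinfty// lee_fin.
have mI (c : 'I_n.+1 -> R) (c0 : forall k, 0 <= c k) :
    (\int[msum (fun j => mscale (NngNum (c0 (inord j))) (m (inord j))) n.+1]_t
      (chi2_mgf n r t)%:E = (\sum_(k < n.+1) r ^+ k * c k)%:E)%E.
  have mh : measurable_fun setT (fun t : measurableTypeR R => (chi2_mgf n r t)%:E).
    by apply/measurable_EFinP; exact: measurable_chi2_mgf.
  have h0 t : (0 <= (chi2_mgf n r t)%:E)%E by rewrite lee_fin chi2_mgf_ge0.
  rewrite ge0_integral_measure_sum// -sumEFin; apply: eq_bigr => k _.
  rewrite ge0_integral_mscale//= inord_val.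
  by have [_ _ ->] := mP k; rewrite // mulrC.
pose Mp := msum mp n.+1.
(* Adding the negative parts of the [v k] to the law of D yields the mixture [Mp] with the positive
   parts: an identity between finite measures, from which the integrals can be subtracted at the
   end. *)
pose Mq := measure_add (distribution P Dm) (msum mq n.+1).
have MqE (A : set (measurableTypeR R)) :
    Mq A = (distribution P Dm A + msum mq n.+1 A)%E by exact: measure_addE.
have Mpq (A : set (measurableTypeR R)) : measurable A -> Mq A = Mp A.
  move=> mA; apply: eq_finite_measure_itvNyc => //.
  - rewrite [X in (X < _)%E]MqE probability_setT lte_add_pinfty ?ltry//.
    exact: mfin.
  - exact: mfin.
  - move=> t; rewrite [LHS]MqE cdfD /Mp /mp /mq !mE -EFinD -big_split/=.
    rewrite [RHS](mE _ p0); congr EFin; apply: eq_bigr => k _.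
    by rewrite -mulrDr [in LHS](_ : v k + _ = Num.max (v k) 0)// {1}pq subrK.
have mh : measurable_fun setT (fun t : measurableTypeR R => (chi2_mgf n r t)%:E).
  by apply/measurable_EFinP; exact: measurable_chi2_mgf.
have h0 t : (0 <= (chi2_mgf n r t)%:E)%E by rewrite lee_fin chi2_mgf_ge0.
have : (\int[Mq]_t (chi2_mgf n r t)%:E = \int[Mp]_t (chi2_mgf n r t)%:E)%E.
  by apply: eq_measure_integral => A mA _; exact: Mpq.
rewrite ge0_integral_measure_add// /Mp /mp /mq !mI.
rewrite (ge0_integral_distribution Dm mh)// => E.
have -> : (\int[P]_w (chi2_mgf n r (D w))%:E = (\sum_(k < n.+1)
    r ^+ k * Num.max (v k) 0)%:E - (\sum_(k < n.+1)
    r ^+ k * Num.max (- v k) 0)%:E)%E.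
  by rewrite -E addeK.
rewrite -EFinB -sumrB; congr EFin; apply: eq_bigr => k _.
by rewrite [in RHS]pq mulrBr.
Qed.

Let s : R := 1 - r ^- 2.

Lemma integral_expR_sqr_dist :
  (\int[P]_w (expR (s / 2 * (U w * (1 - D w))))%:E =
   (\sum_(k < n.+1) r ^+ k * v k)%:E)%E.
Proof.
rewrite -integral_chi2.
pose F (z : R * R) : \bar R :=
  (expR (s / 2 * (z.1 * (1 - z.2))))%:E.
have mF : measurable_fun setT F.
  apply/measurable_EFinP; apply: measurableT_comp => //.
  apply: measurable_funM => //; apply: measurable_funM => //.
  by apply: measurable_funB => //; exact: measurable_snd.
have F0 z : (0 <= F z)%E by rewrite lee_fin expR_ge0.
have mUD := measurable_fun_pair (measurable_funPT Um) (measurable_funPT Dm).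
transitivity (\int[pushforward P (fun w => (Um w, Dm w))]_z F z)%E.
  by rewrite (@ge0_integral_pushforward _ _ _ _ R _ mUD P setT F measurableT mF).
transitivity (\int[(distribution P Um \x distribution P Dm)%E]_z F z)%E.
  apply: eq_measure_integral => A mA _.
  apply: (@product_law _ _ _ T _ _ R P (distribution P Um) (distribution P Dm)) => //.
  by move=> B A' mB mA'; exact: joint.
rewrite (@fubini_tonelli1 _ _ _ _ R (distribution P Um) (distribution P Dm) F)//.
(* The order is exchanged so that U is integrated first, with D fixed. *)
rewrite [LHS](@fubini_tonelli _ _ _ _ R (distribution P Um) (distribution P Dm) F)//.
have mG := @measurable_fun_fubini_tonelli_G _ _ _ _ R (distribution P Um) F mF F0.
rewrite (ge0_integral_distribution Dm mG); last first.
  by move=> t; apply: integral_ge0.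
apply: eq_integral => w _ /=; rewrite /fubini_G.
have /andP[D0 D1] := D01 w.
have rV0 : 0 < r ^- 2 by rewrite invr_gt0 exprn_gt0.
pose y := D w + (1 - D w) * r ^- 2.
have y0 : 0 < y.
  have [D0'|] := ltP 0 (D w); first by rewrite ltr_wpDr// mulr_ge0 ?subr_ge0// ltW.
  by rewrite le_eqVlt ltNge D0 orbF /y => /eqP ->; rewrite add0r subr0 mul1r.
(* Positivity of [y] is what places s (1 - D) below 1, the range where the exponential moment of U
   is finite. *)
have sy : 1 - s * (1 - D w) = y by rewrite /s /y; ring.
have s1 : s * (1 - D w) < 1 by rewrite -subr_gt0 sy.
transitivity (\int[P]_w' (F (U w', D w)))%E.
  apply: (ge0_integral_distribution Um); last by move=> u; exact: F0.
  exact: measurableT_comp.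
transitivity (\int[P]_w' (expR (s * (1 - D w) / 2 * enorm (X w') ^+ 2))%:E)%E.
  by apply: eq_integral => w' _; rewrite /F /=; congr (expR _)%:E;
    rewrite /U /sqnorm; ring.
rewrite (integral_expR_sqr_enorm gX s1) sy; congr EFin.
rewrite /chi2_mgf indicE mem_set; last by rewrite /= in_itv/= D0.
rewrite mul1r -/y (_ : - (n%:R / 2) = 2^-1 * - n%:R); last by ring.
by rewrite powRrM powR12_sqrt ?ltW// powR_invn ?sqrtr_ge0// exprVn.
Qed.

End expectation_formula.

Theorem theorem3p10 (R : realType) (n : nat) (hn : (0 < n)%N)
    (d : measure_display) (T : measurableType d) (P : probability T R)
    (N : 'I_n -> {RV P >-> R}) (hN : standard_gaussian N)
    (M : set 'rV[R]_n) (hM : borel_set M)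
    (v : 'I_n.+1 -> R) (hv : conic_intrinsic_volumes (pos_hull M) v)
    (r : R) (hr : 0 < r) :
  'E_P[fun w => (expR ((1 - r ^- 2) / 2 *
      sup [set Num.max (dotv (rvec N w) x) 0 ^+ 2 / enorm x ^+ 2
          | x in conv_hull M `\ (0 : 'rV[R]_n)]))%R]%E =
  (\sum_(k < n.+1) r ^+ k * v k)%:E.
Proof.
rewrite unlock.
have cC := convex_cone_pos_hull M.
have gN := standard_gaussian_vector hN.
rewrite -(integral_expR_sqr_dist gN hn cC hv hr).
apply: eq_integral => w _; congr (expR (_ * _))%:E.
rewrite sup_sqr_cos_dist /sqnorm /normalize_vec.
set x := rvec N w.
(* The exponents are compared at every point. Where N = 0 the direction is a default value, but both
   sides are 0; elsewhere the distance scales with the norm. *)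
have [x0|x0] := eqVneq x 0.
  have := dist_to_le_enorm x cC; rewrite x0 enorm0 => d0.
  have -> : dist_to 0 (pos_hull M) = 0.
    by apply/eqP; rewrite eq_le d0 dist_to_ge0.
  by rewrite !expr0n/= subr0 mul0r.
have nx0 : 0 < enorm x by rewrite lt_neqAle eq_sym enorm_eq0 x0 enorm_ge0.
rewrite dist_to_scale ?invr_gt0// exprMn exprVn.
by field; rewrite gt_eqF.
Qed.
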